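(* Let $1<p<\infty$, let $\Omega\subset\mathbb{R}^n$ be a bounded domain, and let $\mu$, $Q$, $v$ be as in the context. Let $\rho$ be a quasimetric on $\Omega$ satisfying the standing conditions of the context and such that $(\Omega,\rho)$ is locally geometrically doubling. Let $E\Subset\Omega$ be open. Suppose that (1) $(\Omega,\rho)$ supports a local Poincar\'e property of order $p$, and (2) $(\Omega,\rho)$ supports a local Sobolev property of order $p$ and gain $\sigma$ for some $\sigma>1$. Then for every $q\in[1,p\sigma)$ the space $QH^{1,p}_0(v,\mu;E)$ is compactly embedded in $L^q_v(\mu;E)$ through the projection $\pi((u,\nabla u))=u$; that is, $\pi$ maps $QH^{1,p}_0(v,\mu;E)$ into $L^q_v(\mu;E)$, and for every bounded sequence in $QH^{1,p}_0(v,\mu;E)$ the image sequence under $\pi$ has a subsequence converging in $L^q_v(\mu;E)$.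
   Context: Setting. $\Omega\subset\mathbb{R}^n$ is a bounded, open, connected set; $\mu$ is a regular measure on $\Omega$, absolutely continuous with respect to Lebesgue measure. $Q$ is a $\mu$-measurable function on $\Omega$ with values in the non-negative definite self-adjoint (real symmetric) $n\times n$ matrices, and $\sqrt{Q(x)}$ is the non-negative definite square root. Put $v_0(x)=\|Q(x)\|_{\mathrm{op}}^{p/2}$, where $\|Q(x)\|_{\mathrm{op}}=\sup_{|\xi|=1}|Q(x)\xi|$. It is assumed that $\sqrt Q\in L^p(\mu;\Omega)$. $v$ is a weight on $\Omega$ (a nonnegative function locally integrable with respect to $\mu$) for which there is $c_2>0$ with $v_0(x)\le c_2v(x)$ for $x\in\Omega$. Write $v(B)=\int_B v\,d\mu$, and let $L^q_v(\mu;E)$ be the space with norm $\|f\|_{L^q_v(\mu;E)}=(\int_E|f|^qv\,d\mu)^{1/q}$. $E\Subset\Omega$ means that the closure of $E$ is a compact subset of $\Omega$. Sobolev space. For a locally Lipschitz function $f$ and a measurable set $A\subset\Omega$ let $$\|(f,\nabla f)\|_{QH^{1,p}(v,\mu;A)}=\Big(\int_A|f|^pv\,d\mu\Big)^{1/p}+\Big(\int_A|\sqrt Q\,\nabla f|^p\,d\mu\Big)^{1/p}.$$ For an open set $E\subset\Omega$, $Lip_0(E)$ is the set of locally Lipschitz functions with compact support in $E$. $\mathcal L^p_Q(\mu;E)$ is the space of $\mu$-measurable vector fields $\vec k$ on $E$ with $\|\vec k\|_{\mathcal L^p_Q(\mu;E)}=(\int_E|\sqrt Q\,\vec k|^pd\mu)^{1/p}<\infty$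 (modulo fields of zero norm). $QH^{1,p}_0(v,\mu;E)$ is the completion of $Lip_0(E)$ with respect to $\|\cdot\|_{QH^{1,p}(v,\mu;E)}$, identified with the closure of $\{(f,\nabla f):f\in Lip_0(E)\}$ in $L^p_v(\mu;E)\times\mathcal L^p_Q(\mu;E)$; its elements are written as pairs $(u,\nabla u)$, where the second component $\nabla u$ denotes the $\mathcal L^p_Q$-limit of gradients of an approximating sequence. Quasimetric. $\rho$ is a quasimetric on $\Omega$: for some $\kappa\ge1$ and all $x,y,z\in\Omega$, $\rho(x,y)\ge0$ with equality only if $x=y$, $\rho(x,y)=\rho(y,x)$, and $\rho(x,y)\le\kappa(\rho(x,z)+\rho(z,y))$. $B(x,r)=\{y\in\Omega:\rho(x,y)<r\}$. Standing conditions: all $\rho$-balls are open (in the Euclidean topology), and for every $x\in\Omega$ there is $\delta(x)>0$ with $\overline{B(x,r)}\subset\Omega$ for $0<r<\delta(x)$. Locally geometrically doubling: there is a function $C:(0,\infty)\to(0,\infty)$ such that for every compact $K\subset\Omega$ there is $\delta>0$ such that whenever $0<s\le r<\delta$ and $x\in K$, the ball $B(x,r)$ contains at most $C(r/s)$ centers of disjoint $\rho$-balls of radius $s$ ($C$ is independent of $K$). Local Poincar\'e property of order $p$: there is $c_0\ge1$ such that for every compact $K\subset\Omega$ and $\epsilon>0$ there is $\delta_1>0$ such that for $0<r<\delta_1$ and $x\in K$, $$\|f-f_{B(x,r)}\|_{L^p_v(\mu;B(x,r))}\le\epsilon\,\|(f,\nabla f)\|_{QH^{1,p}(v,\mu;B(x,c_0r))}$$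 for every locally Lipschitz $f$ on $\Omega$, where $f_B=\frac1{v(B)}\int_Bfv\,d\mu$. Local Sobolev property of order $p$ and gain $\sigma$ ($\sigma\ge1$): for every compact $K\subset\Omega$ there is $\delta_2>0$ such that for every ball $B=B(x,r)$ with $x\in K$ and $0<r<\delta_2$ there is a constant $C(B)$ with $$\Big(\int_B|f|^{p\sigma}v\,d\mu\Big)^{1/(p\sigma)}\le C(B)\,\|(f,\nabla f)\|_{QH^{1,p}(v,\mu;\Omega)}$$ for every $f\in Lip_0(B)$ (extended by zero to $\Omega$).
   Formalization: The quasimetric is also required to satisfy ρ(x,x)=0 (equality if and only if x=y); with ''only if'' alone the claim fails, e.g. ρ≡1, Q=0, v=1, where small balls are empty and all the ball hypotheses hold vacuously. *)

(* Defs.v *)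
From HB Require Import structures.
From mathcomp Require Import all_boot all_order all_algebra.
From mathcomp Require Import all_classical all_reals all_analysis.
Import Order.TTheory GRing.Theory Num.Theory.
Import numFieldNormedType.Exports.

Set Implicit Arguments.
Unset Strict Implicit.
Unset Printing Implicit Defensive.

Local Open Scope classical_set_scope.
Local Open Scope ring_scope.

(* Points and vectors of R^n are row vectors. The norm `|x| that the library
   puts on 'rV[R]_n is the sup norm; it is used only for notions that do not
   depend on the choice of a norm (topology, boundedness, Lipschitz functions).
   The Euclidean norm is enorm. *)
Section linear_algebra.
Context {R : realType} {n : nat}.
Implicit Types (A S : 'M[R]_n) (xi : 'rV[R]_n).

Definition enorm xi : R := Num.sqrt (\sum_i xi 0 i ^+ 2).

(* the row vector of the matrix-vector product A xi *)
Definition mulmxv A xi : 'rV[R]_n := xi *m A^T.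

Definition opnorm A : R := sup [set enorm (mulmxv A xi) | xi in [set xi | enorm xi = 1]].

Definition psdmx A : Prop :=
  A^T = A /\ forall xi, 0 <= \sum_i xi 0 i * mulmxv A xi 0 i.

(* A nonnegative definite A has exactly one nonnegative definite square root;
   the default value 0 is used only for other matrices. *)
Definition sqrtmx A : 'M[R]_n := xget 0 [set S | psdmx S /\ S *m S = A].

End linear_algebra.

(* n-dimensional Lebesgue measure by integration over slices: for Borel sets,
   on which alone it is used, this is the iterated integral of the indicator
   function, as in the library's product measures. *)
Fixpoint lebesgue_rV {R : realType} (n : nat) : set 'rV[R]_n -> \bar R :=
  match n with
  | 0%N => fun A => (\1_A (0 : 'rV[R]_0))%:E
  | m.+1 => fun A =>
      (\int[@lebesgue_measure R]_t
         lebesgue_rV [set y : 'rV[R]_m | A (row_mx t%:M y : 'rV[R]_(1 + m))])%E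
  end.

Section functions.
Context {R : realType} {n : nat}.
Implicit Types (f : 'rV[R]_n -> R) (A E K : set 'rV[R]_n) (x : 'rV[R]_n).

Definition compactly_inside E A := compact (closure E) /\ closure E `<=` A.

Definition locally_lipschitz A f :=
  forall x, A x -> exists2 U, nbhs x U & [lipschitz f y | y in U].

(* Elements of Lip_0(E) are total functions that vanish outside E, so that
   extension by zero is implicit. *)
Definition Lip0 E f :=
  locally_lipschitz E f /\ compactly_inside [set x | f x != 0] E.

(* The partial derivatives of a locally Lipschitz function exist almost
   everywhere; elsewhere 'D_v f x has an arbitrary value. *)
Definition grad f x : 'rV[R]_n := \row_i 'D_(delta_mx 0 i) f x.

End functions.

(* mu is a measure on a sigma-algebra M of subsets of R^n that contains the
   Borel sets, and mu-measurable means measurable with respect to M. Only the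
   values of mu on subsets of Omega are used. *)
Section measures.
Context {R : realType} {n : nat} {M : set (set 'rV[R]_n)}.
Variable mu : {measure set (g_sigma_algebraType M) -> \bar R}.
Implicit Types (Omega A E B : set 'rV[R]_n) (f u v : 'rV[R]_n -> R).
Implicit Types (k : 'rV[R]_n -> 'rV[R]_n) (Q : 'rV[R]_n -> 'M[R]_n).

Definition mu_measurable A f :=
  measurable_fun (A : set (g_sigma_algebraType M)) (f : g_sigma_algebraType M -> R).

Definition regular_measure Omega := forall A, M A -> A `<=` Omega ->
  mu A = ereal_inf [set mu U | U in [set U | [/\ open U, A `<=` U & U `<=` Omega]]] /\
  mu A = ereal_sup [set mu K | K in [set K | compact K /\ K `<=` A]].

Definition abs_continuous_lebesgue Omega := forall A,
  <<s open >> A -> A `<=` Omega -> lebesgue_rV A = 0%E -> mu A = 0%E.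

Definition weight Omega v :=
  [/\ mu_measurable Omega v, forall x, Omega x -> 0 <= v x &
      forall K, compact K -> K `<=` Omega -> (\int[mu]_(x in K) (v x)%:E < +oo)%E].

Definition Lv_norm v (q : R) A f : \bar R :=
  ((\int[mu]_(x in A) (`|f x| `^ q * v x)%:E) `^ q^-1)%E.

Definition in_Lv v (q : R) A f := mu_measurable A f /\ (Lv_norm v q A f < +oo)%E.

Definition LQ_norm Q (p : R) A k : \bar R :=
  ((\int[mu]_(x in A) (enorm (mulmxv (sqrtmx (Q x)) (k x)) `^ p)%:E) `^ p^-1)%E.

Definition in_LQ Q (p : R) A k :=
  (forall i, mu_measurable A (fun x => k x 0 i)) /\ (LQ_norm Q p A k < +oo)%E.

Definition sqrt_in_Lp Q (p : R) Omega :=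
  (forall i j, mu_measurable Omega (fun x => sqrtmx (Q x) i j)) /\
  (\int[mu]_(x in Omega) (opnorm (sqrtmx (Q x)) `^ p)%:E < +oo)%E.

Definition QH_norm Q v (p : R) A f k : \bar R :=
  (Lv_norm v p A f + LQ_norm Q p A k)%E.

(* (u, k) represents an element of QH^{1,p}_0(v, mu; E); the second component
   is an independent datum, since it need not be determined by u. *)
Definition QH0 Q v (p : R) E u k :=
  [/\ in_Lv v p E u, in_LQ Q p E k &
      exists f : nat -> 'rV[R]_n -> R, (forall j, Lip0 E (f j)) /\
        QH_norm Q v p E (f j \- u) (grad (f j) \- k) @[j --> \oo] --> 0%E].

Definition average v B f : R :=
  (\int[mu]_(x in B) (f x * v x)) / (\int[mu]_(x in B) v x).

Definition qball Omega (rho : 'rV[R]_n -> 'rV[R]_n -> R) x (r : R) : set 'rV[R]_n :=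
  [set y | Omega y /\ rho x y < r].

Definition quasimetric Omega (rho : 'rV[R]_n -> 'rV[R]_n -> R) :=
  exists kappa : R, 1 <= kappa /\
    forall x y z, Omega x -> Omega y -> Omega z ->
      [/\ 0 <= rho x y, rho x y = 0 <-> x = y, rho x y = rho y x &
          rho x y <= kappa * (rho x z + rho z y)].

Definition balls_open Omega rho :=
  forall x r, Omega x -> 0 < r -> open (qball Omega rho x r).

Definition small_balls_inside Omega rho := forall x, Omega x ->
  exists2 delta : R, 0 < delta &
    forall r, 0 < r -> r < delta -> closure (qball Omega rho x r) `<=` Omega.

Definition locally_geometrically_doubling Omega rho :=
  exists C : R -> R, (forall t, 0 < t -> 0 < C t) /\
    forall K, compact K -> K `<=` Omega -> exists2 delta : R, 0 < delta &
      forall s r x, 0 < s -> s <= r -> r < delta -> K x ->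
        forall (m : nat) (y : 'I_m -> 'rV[R]_n),
          (forall i, qball Omega rho x r (y i)) ->
          trivIset [set: 'I_m] (fun i => qball Omega rho (y i) s) ->
          m%:R <= C (r / s).

Definition local_poincare Omega Q v (p : R) rho :=
  exists c0 : R, 1 <= c0 /\
    forall K, compact K -> K `<=` Omega -> forall eps : R, 0 < eps ->
      exists2 delta1 : R, 0 < delta1 &
        forall r x, 0 < r -> r < delta1 -> K x ->
          forall f, locally_lipschitz Omega f ->
            (Lv_norm v p (qball Omega rho x r)
               (fun y => f y - average v (qball Omega rho x r) f)%R
             <= eps%:E * QH_norm Q v p (qball Omega rho x (c0 * r)) f (grad f))%E.

Definition local_sobolev Omega Q v (p sigma : R) rho :=
  forall K, compact K -> K `<=` Omega -> exists2 delta2 : R, 0 < delta2 &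
    forall x r, K x -> 0 < r -> r < delta2 ->
      exists C : R, forall f, Lip0 (qball Omega rho x r) f ->
        (Lv_norm v (p * sigma) (qball Omega rho x r) f
         <= C%:E * QH_norm Q v p Omega f (grad f))%E.

End measures.

(* Main.v *)
Require Import Defs.
From HB Require Import structures.
From mathcomp Require Import all_boot all_order all_algebra.
From mathcomp Require Import all_classical all_reals all_analysis.
From mathcomp Require Import measurable_realfun ring lra.
Import Order.TTheory GRing.Theory Num.Theory.
Import numFieldNormedType.Exports.

(** Put r = p sigma and let (u_j, k_j) be a bounded sequence in QH_0. Every u_j
    is approximated in L^p_v by a function f_j of Lip_0(E), and the energies
    int |f_j|^p v and int |sqrt Q grad f_j|^p have a common bound
    ([QH0_approximation]). Two estimates on such functions carry the proof.

    The first is a Sobolev inequality on E ([global_sobolev]). Around each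
    point of the closure of E there is a smooth cut-off function psi supported
    in a small rho-ball, to which the local Sobolev inequality for psi f
    applies. The new term f grad psi in the gradient is harmless, because
    |sqrt Q w|^2 <= |Q|_op |w|^2 and |Q|_op^(p/2) <= c2 v, so that it is
    controlled by int |f|^p v. Since the closure of E is compact, finitely many
    of these points suffice, and int |f_j|^r v is bounded; a truncation
    argument ([Lv_pow_limit_le]) passes the bound on to u_j.

    The second is a Poincare estimate on E ([poincare_cover]). A Vitali family
    of balls of a small radius covers E, and the doubling condition bounds the
    overlap of the dilated balls by a number N that does not depend on the
    radius. The local Poincare inequality, summed over the family, gives
      int_E |f - g|^p v <= eta + C sum_B |f_B - g_B|^p
    with eta as small as desired. Only finitely many bounded quantities, the
    averages over the balls, remain; along a free ultrafilter on the indices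
    all bounded sequences are Cauchy, hence some subsequence of (f_j), and with
    it of (u_j), is Cauchy in L^p_v
    ([totally_bounded_cauchy_subsequence]).

    A sequence that is bounded in L^r_v and Cauchy in L^p_v converges in L^q_v
    for every q < r, by the inequality t^q <= e (1 + t^r) + C t^p
    ([Lv_cauchy_limit]).

    The library's derivative is 0 where the difference quotients diverge, and
    its integral of a nonnegative function is the supremum of the integrals of
    the simple functions below it. The product rule is therefore proved as an
    inequality valid at every point ([grad_cutoff]), and the integrals of
    |sqrt Q grad f|^p are handled through properties that this supremum has for
    all nonnegative functions. *)

Set Implicit Arguments.
Unset Strict Implicit.
Unset Printing Implicit Defensive.

Local Open Scope classical_set_scope.
Local Open Scope ring_scope.

(** * Inequalities for real powers *)

Section real_inequalities.
Context {R : realType}.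
Implicit Types a b c p q r s t : R.

Lemma powR_add_le p a b : 0 <= p -> 0 <= a -> 0 <= b ->
  (a + b) `^ p <= 2 `^ p * (a `^ p + b `^ p).
Proof.
move=> p0; wlog ab : a b / a <= b => [H a0 b0|a0 b0].
  have [/H|/ltW ba] := leP a b; first exact.
  by rewrite addrC [X in _ * X]addrC; exact: H.
apply: (@le_trans _ _ ((2 * b) `^ p)).
  by apply: ge0_ler_powR => //; rewrite ?nnegrE; lra.
by rewrite powRM// ler_wpM2l ?powR_ge0// lerDr powR_ge0.
Qed.

Lemma powR_add3_le p a b c : 0 <= p -> 0 <= a -> 0 <= b -> 0 <= c ->
  (a + b + c) `^ p <= 4 `^ p * (a `^ p + b `^ p + c `^ p).
Proof.
move=> p0 a0 b0 c0.
have le1 : 1 <= 2 `^ p :> R by rewrite -[leLHS](powRr0 2) ler_powR//; lra.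
rewrite (_ : 4 = 2 * 2)%R; last by lra.
apply: (le_trans (powR_add_le p0 (addr_ge0 a0 b0) c0)).
rewrite powRM// -mulrA ler_wpM2l ?powR_ge0//.
rewrite [leRHS]mulrDr lerD ?powR_add_le// ler_peMl ?powR_ge0//.
Qed.

(** For t small, t `^ q is at most e; for t large, t `^ r dominates; the
    compact range between is left to t `^ p. *)
Lemma powR_interpolation p q r e : 0 < p -> 0 < q -> q < r -> 0 < e ->
  exists2 C, 0 <= C & forall t, 0 <= t ->
    t `^ q <= e * (1 + t `^ r) + C * t `^ p.
Proof.
move=> p0 q0 qr e0.
(* The two thresholds: t `^ q <= e up to t = a, and
   t `^ q <= e * t `^ r from t = T on. *)
pose a := e `^ (q^-1); pose T := e `^ ((q - r)^-1).
have a0 : 0 < a by rewrite powR_gt0.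
have T0 : 0 < T by rewrite powR_gt0.
have aq : a `^ q = e by rewrite -powRrM mulVf ?powRr1 ?gt_eqF// ltW.
have Tq : T `^ (q - r) = e.
  by rewrite -powRrM mulVf ?powRr1 ?lt_eqF ?subr_lt0// ltW.
exists (T `^ q / a `^ p) => [|t t0]; first by rewrite divr_ge0 ?powR_ge0.
have Cp : 0 <= T `^ q / a `^ p * t `^ p by rewrite mulr_ge0 ?divr_ge0 ?powR_ge0.
have etr : 0 <= e * t `^ r by rewrite mulr_ge0 ?powR_ge0// ltW.
have [ta|at_] := leP t a.
  have : t `^ q <= e.
    by rewrite -aq ge0_ler_powR// ?nnegrE// ltW.
  by rewrite mulrDr mulr1 -addrA => /le_trans; apply; rewrite lerDl addr_ge0.
have [tT|Tt] := leP t T.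
  have : t `^ q <= T `^ q / a `^ p * t `^ p.
    have : t `^ q <= T `^ q by rewrite ge0_ler_powR// ?nnegrE// ltW.
    move/le_trans; apply; rewrite -mulrA ler_peMr ?powR_ge0//.
    rewrite mulrC ler_pdivlMr ?powR_gt0// mul1r.
    by rewrite ge0_ler_powR ?nnegrE// ltW.
  by move/le_trans; apply; rewrite lerDr mulr_ge0 ?addr_ge0 ?powR_ge0// ltW.
have : t `^ q <= e * t `^ r.
  have tp : 0 < t by exact: lt_trans Tt.
  rewrite -{1}(subrK r q) powRD; last by rewrite (gt_eqF tp) implybT.
  rewrite ler_wpM2r ?powR_ge0// -Tq -[q - r]opprK.
  rewrite powRN [leRHS]powRN lef_pV2 ?posrE ?powR_gt0// opprB.
  by rewrite ge0_ler_powR// ?nnegrE ?subr_ge0 ?opprB// ltW.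
move/le_trans; apply; rewrite mulrDr mulr1 addrAC lerDr.
by rewrite addr_ge0// ltW.
Qed.

End real_inequalities.

(** * Integrals of nonnegative functions, measurable or not *)

Section nonmeasurable_integrands.
Local Open Scope ereal_scope.
Context d (T : measurableType d) (R : realType) (mu : {measure set T -> \bar R}).
Implicit Types (f g h : T -> \bar R) (D : set T).

Import HBNNSimple.

(** The integral of a nonnegative function, measurable or not, is the supremum
    of the integrals of the simple functions below it. This lemma and the next
    are the two directions of that definition; the inequalities below for
    nonmeasurable functions are derived through them. *)
Lemma integral_inner_le D f (X : \bar R) :
  (forall x, D x -> 0 <= f x) ->
  (forall h : {nnsfun T >-> R}, (forall x, (h x)%:E <= (f \_ D) x) ->
     \int[mu]_x (h x)%:E <= X) ->
  \int[mu]_(x in D) f x <= X.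
Proof.
move=> f0 H; rewrite ge0_integralE//; apply: ge_ereal_sup => _ [h /= hf <-].
by rewrite -integralT_nnsfun; exact: H.
Qed.

Lemma nnsfun_le_integral D f (h : {nnsfun T >-> R}) :
  (forall x, D x -> 0 <= f x) -> (forall x, (h x)%:E <= (f \_ D) x) ->
  \int[mu]_x (h x)%:E <= \int[mu]_(x in D) f x.
Proof.
move=> f0 hf; rewrite (ge0_integralE mu f0); apply: ereal_sup_ubound => /=.
by exists h => //; rewrite integralT_nnsfun.
Qed.

Lemma le_integral_inner D D' f g : D `<=` D' ->
  (forall x, D x -> 0 <= f x) -> (forall x, D' x -> 0 <= g x) ->
  (forall x, D x -> f x <= g x) ->
  \int[mu]_(x in D) f x <= \int[mu]_(x in D') g x.
Proof.
move=> DD' f0 g0 fg; apply: integral_inner_le => // h hf.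
apply: nnsfun_le_integral => // x; apply: (le_trans (hf x)).
rewrite !patchE; case: ifPn => [|_].
  by rewrite inE => Dx; rewrite mem_set ?fg//; exact: DD'.
by case: ifPn => //; rewrite inE => D'x; exact: g0.
Qed.

Lemma measurable_le_integral_inner D f h :
  measurable_fun setT h -> (forall x, 0 <= h x) ->
  (forall x, D x -> 0 <= f x) ->
  (forall x, h x <= (f \_ D) x) -> \int[mu]_x h x <= \int[mu]_(x in D) f x.
Proof.
move=> mh h0 f0 hf; rewrite [leRHS]integral_mkcond.
by apply: le_integral_inner => // x _; apply: erestrict_ge0.
Qed.

(** Subadditivity may fail for two nonmeasurable functions, but holds as soon as
    one of them is measurable: if the simple function h lies below f + g, then
    the positive part of h - g is a measurable minorant of f. *)
Lemma integral_innerD_le D f g : measurable D -> measurable_fun D g ->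
  (forall x, D x -> 0 <= f x) -> (forall x, D x -> 0 <= g x) ->
  \int[mu]_(x in D) (f x + g x) <=
    \int[mu]_(x in D) f x + \int[mu]_(x in D) g x.
Proof.
move=> mD mg f0 g0; apply: integral_inner_le => [x Dx|h hfg].
  by rewrite adde_ge0 ?f0 ?g0.
pose G := g \_ D.
have G0 x : 0 <= G x by apply: erestrict_ge0.
have mG : measurable_fun setT G by exact/(measurable_restrictT _ _).1.
pose k x := maxe ((h x)%:E - G x) 0.
have mh : measurable_fun setT (EFin \o h) by exact: measurableT_comp.
have mk : measurable_fun setT k.
  by apply: measurable_maxe => //; exact: emeasurable_funB.
have k0 x : 0 <= k x by rewrite /k le_max lexx orbT.
have hk x : (h x)%:E <= k x + G x.
  rewrite /k; have := G0 x; case: (G x) => [r r0|_|//]; last first.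
    rewrite addey ?leey// -ltNye (lt_le_trans (ltNyr 0))//.
    by rewrite le_max lexx orbT.
  by rewrite -leeBlDr// le_max lexx.
apply: (@le_trans _ _ (\int[mu]_x (k x + G x))).
  apply: ge0_le_integral => //; first by move=> x _; rewrite lee_fin.
  by apply: emeasurable_funD.
rewrite ge0_integralD// leeD//; last by rewrite [leRHS]integral_mkcond.
apply: measurable_le_integral_inner => // x.
rewrite /k; have := hfg x; rewrite /G !patchE; case: ifPn => [|_].
  rewrite inE => Dx hx; rewrite ge_max f0// andbT.
  have := g0 _ Dx; move: hx; case: (g x) => [r|_ _|//].
    by rewrite leeBlDr.
  by rewrite addeNy ?leNye//.
by move=> hx; rewrite ge_max lexx andbT sube0.
Qed.

(** The sum of two simple minorants is a minorant of the sum, so superadditivity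
    holds without measurability. The suprema over the two minorants are taken
    one after the other, by subtraction; hence the reduction to finite
    integrals. *)
Lemma integral_inner_superD D f g :
  (forall x, D x -> 0 <= f x) -> (forall x, D x -> 0 <= g x) ->
  \int[mu]_(x in D) f x + \int[mu]_(x in D) g x <=
    \int[mu]_(x in D) (f x + g x).
Proof.
move=> f0 g0; set X := (leRHS).
have fg0 x : D x -> 0 <= f x + g x by move=> Dx; rewrite adde_ge0 ?f0 ?g0.
have [->|XNy] := eqVneq X +oo; first exact: leey.
have X0 : 0 <= X by exact: integral_ge0.
have Xfin : X \is a fin_num by rewrite ge0_fin_numE// lt_neqAle XNy leey.
have key (h k : {nnsfun T >-> R}) : (forall x, (h x)%:E <= (f \_ D) x) ->
    (forall x, (k x)%:E <= (g \_ D) x) ->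
    \int[mu]_x (h x)%:E + \int[mu]_x (k x)%:E <= X.
  move=> hf kg; rewrite -ge0_integralD//; last 4 first.
    by move=> x _; rewrite lee_fin.
    exact: measurableT_comp.
    by move=> x _; rewrite lee_fin.
    exact: measurableT_comp.
  apply: measurable_le_integral_inner => //.
  - by apply: emeasurable_funD; exact: measurableT_comp.
  - by move=> x; rewrite adde_ge0// lee_fin.
  - move=> x; have := hf x; have := kg x; rewrite !patchE; case: ifPn => _ kx hx.
      exact: leeD.
    by apply: (le_trans (leeD hx kx)); rewrite adde0.
have [fy|fNy] := eqVneq (\int[mu]_(x in D) f x) +oo.
  rewrite (_ : X = +oo) ?leey//; apply/eqP; rewrite -leye_eq -fy.
  by apply: le_integral_inner => // x Dx; rewrite leeDl// g0.
have ffin : \int[mu]_(x in D) f x \is a fin_num.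
  by rewrite ge0_fin_numE ?integral_ge0// lt_neqAle fNy leey.
rewrite addeC -leeBrDr//; apply: integral_inner_le => // k kg.
rewrite leeBrDr// addeC.
have kX : \int[mu]_x (k x)%:E <= X.
  have := key nnsfun0 k; rewrite [X in X + _]integral0_eq// add0e; apply => //.
  by move=> x; rewrite /=; apply: erestrict_ge0.
have kfin : \int[mu]_x (k x)%:E \is a fin_num.
  rewrite ge0_fin_numE ?integral_ge0//; last by move=> x _; rewrite lee_fin.
  by apply: (le_lt_trans kX); rewrite -ge0_fin_numE.
rewrite -leeBrDr//; apply: integral_inner_le => // h hf.
by rewrite leeBrDr//; exact: key.
Qed.

Lemma integral_inner_sum_le D (I : Type) (s : seq I) (F : I -> T -> \bar R) :
  (forall i x, D x -> 0 <= F i x) ->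
  \sum_(i <- s) \int[mu]_(x in D) F i x <=
    \int[mu]_(x in D) \sum_(i <- s) F i x.
Proof.
move=> F0; elim: s => [|i s IH].
  by rewrite big_nil; apply: integral_ge0 => x _; rewrite big_nil.
rewrite big_cons.
rewrite [leRHS](_ : _ =
    \int[mu]_(x in D) (F i x + \sum_(j <- s) F j x)); last first.
  by apply: eq_integral => x _; rewrite big_cons.
apply: (le_trans (leeD2l _ IH)); apply: integral_inner_superD => [x|x Dx].
  exact: F0.
by apply: sume_ge0 => j _; exact: F0.
Qed.

(** For c > 0, division by c maps the minorants of c * f to minorants of f. *)
Lemma integral_innerZ_le D (c : R) f : (0 <= c)%R ->
  (forall x, D x -> 0 <= f x) ->
  \int[mu]_(x in D) (c%:E * f x) <= c%:E * \int[mu]_(x in D) f x.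
Proof.
rewrite le_eqVlt => /predU1P[<- f0|c0 f0].
  by rewrite integral0_eq ?mul0e// => x _; rewrite mul0e.
apply: integral_inner_le => [x Dx|h hf]; first by rewrite mule_ge0 ?f0// lee_fin ltW.
have mh : measurable_fun setT (EFin \o h) by exact: measurableT_comp.
rewrite -lee_pdivrMl// -ge0_integralZl//; last 2 first.
  by move=> x _; rewrite lee_fin.
  by rewrite lee_fin invr_ge0 ltW.
apply: measurable_le_integral_inner => //.
- by apply: measurable_funeM.
- by move=> x; rewrite mule_ge0// lee_fin// invr_ge0 ltW.
- move=> x; rewrite lee_pdivrMl//; apply: (le_trans (hf x)).
  by rewrite !patchE; case: ifPn => // _; rewrite mule0.
Qed.

End nonmeasurable_integrands.

Section domains.
Local Open Scope ereal_scope.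
Context d (T : measurableType d) (R : realType) (mu : {measure set T -> \bar R}).

Lemma integral_eq_support (D E : set T) (g : T -> \bar R) : E `<=` D ->
  (forall x, D x -> ~ E x -> g x = 0) ->
  \int[mu]_(x in D) g x = \int[mu]_(x in E) g x.
Proof.
move=> ED g0; rewrite integral_mkcond [RHS]integral_mkcond; congr (integral _ _ _).
apply/funext => x; rewrite !patchE.
case: ifPn => xD; case: ifPn => xE //.
  by rewrite g0//; [exact: set_mem|move=> Ex; move: xE; rewrite mem_set].
by move: xD; rewrite mem_set//; apply: ED; exact: set_mem.
Qed.

Lemma ge0_integral_setU_le (A B : set T) (g : T -> \bar R) :
  measurable A -> measurable B -> measurable_fun (A `|` B) g ->
  (forall x, (A `|` B) x -> 0 <= g x) ->
  \int[mu]_(x in A `|` B) g x <= \int[mu]_(x in A) g x + \int[mu]_(x in B) g x.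
Proof.
move=> mA mB mg g0; have AB : A `|` B = A `|` (B `\` A).
  apply/seteqP; split=> x; last by move=> [|[]]; [left|right].
  by move=> [|Bx]; [left|have [Ax|nAx] := pselect (A x); [left|right]].
have mBA : measurable (B `\` A) by exact: measurableD.
rewrite [in leLHS]AB ge0_integral_setU//; last 3 first.
- by rewrite -AB.
- by rewrite -AB.
- by rewrite disj_set2E setDIK.
rewrite leeD2l//; apply: ge0_subset_integral => //.
- by apply: measurable_funS mg; [exact: measurableU|exact: subsetUr].
- by move=> x Bx; apply: g0; right.
Qed.

End domains.

Section overlap.
Local Open Scope ereal_scope.
Context d (T : measurableType d) (R : realType) (mu : {measure set T -> \bar R}).

Let sum_indicator (I : Type) (l : seq I) (P : pred I) (c : R) :
  (\sum_(i <- l) (if P i then c else 0) = (count P l)%:R * c)%R.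
Proof.
elim: l => [|i l IH]; first by rewrite big_nil mul0r.
by rewrite big_cons IH /= natrD mulrDl; case: (P i); rewrite ?mul1r ?mul0r.
Qed.

(** The sum of the restrictions of g to the sets B i is at most N * g pointwise,
    and superadditivity goes in the required direction even if g is not
    measurable. *)
Lemma sum_integral_overlap_le (I : Type) (l : seq I) (D : set T) (B : I -> set T)
    (g : T -> R) (N : R) :
  (forall i, B i `<=` D) -> (forall x, D x -> 0 <= g x)%R -> (0 <= N)%R ->
  (forall x, D x -> (count (fun i => `[< B i x >]) l)%:R <= N)%R ->
  \sum_(i <- l) \int[mu]_(x in B i) (g x)%:E <= N%:E * \int[mu]_(x in D) (g x)%:E.
Proof.
move=> BD g0 N0 HN.
have -> : \sum_(i <- l) \int[mu]_(x in B i) (g x)%:E =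
    \sum_(i <- l) \int[mu]_(x in D) ((fun x => (g x)%:E) \_ (B i)) x.
  by apply: eq_bigr => i _; rewrite -integral_mkcondr setIidr.
apply: le_trans (integral_innerZ_le _ N0 _); last by move=> x Dx; rewrite lee_fin g0.
have gB0 i x : D x -> 0 <= ((fun x => (g x)%:E) \_ (B i)) x.
  by move=> Dx; rewrite patchE; case: ifPn => // _; rewrite lee_fin g0.
apply: (le_trans (integral_inner_sum_le _ _ _)); first exact: gB0.
apply: le_integral_inner => // x Dx.
- by apply: sume_ge0 => i _; exact: gB0.
- by rewrite mule_ge0// lee_fin g0.
have -> : \sum_(i <- l) ((fun x => (g x)%:E) \_ (B i)) x =
    \sum_(i <- l) ((if `[< B i x >] then g x else 0)%R)%:E.
  apply: eq_bigr => i _; rewrite patchE; case: ifPn => Bx.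
    by rewrite ifT//; apply/asboolP; exact: set_mem.
  by rewrite ifF//; apply/asboolP => /mem_set; exact/negP.
by rewrite sumEFin sum_indicator -EFinM lee_fin ler_wpM2r ?g0// HN.
Qed.

End overlap.

(** * Weighted integrals of powers *)

Section weighted_powers.
Context d (T : measurableType d) (R : realType) (mu : {measure set T -> \bar R}).
Variables (D : set T) (mD : measurable D) (v : T -> R).
Hypothesis mv : measurable_fun D v.
Hypothesis v0 : forall x, D x -> 0 <= v x.
Implicit Types (g h : T -> R) (p q r e : R).

(** The r-th power of the norm of L^r_v: unlike the norm, it is additive in the
    domain, and it is meaningful for every exponent r > 0. *)
Definition Lv_pow r g : \bar R := (\int[mu]_(x in D) (`|g x| `^ r * v x)%:E)%E.

Lemma measurable_Lv_pow r g : measurable_fun D g ->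
  measurable_fun D (fun x => (`|g x| `^ r * v x)%:E).
Proof.
move=> mg; apply/measurable_EFinP; apply: measurable_funM => //.
apply: (measurableT_comp (measurable_powR r)).
exact: (measurableT_comp (@normr_measurable _ setT)).
Qed.

Lemma Lv_pow_integrand_ge0 r g x : D x -> (0 <= (`|g x| `^ r * v x)%:E)%E.
Proof. by move=> Dx; rewrite lee_fin mulr_ge0 ?powR_ge0 ?v0. Qed.

Lemma Lv_pow_ge0 r g : (0 <= Lv_pow r g)%E.
Proof. by apply: integral_ge0 => x Dx; exact: Lv_pow_integrand_ge0. Qed.

Lemma integral_v_ge0 : (0 <= \int[mu]_(x in D) (v x)%:E)%E.
Proof. by apply: integral_ge0 => x Dx; rewrite lee_fin v0. Qed.

Lemma Lv_powD_le r g h (k : T -> R) : 0 <= r ->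
  measurable_fun D g -> measurable_fun D h -> measurable_fun D k ->
  (forall x, D x -> `|k x| <= `|g x| + `|h x|) ->
  (Lv_pow r k <= (2 `^ r)%:E * (Lv_pow r g + Lv_pow r h))%E.
Proof.
move=> r0 mg mh mk kgh; rewrite /Lv_pow -ge0_integralD//; last 4 first.
- exact: Lv_pow_integrand_ge0.
- exact: measurable_Lv_pow.
- exact: Lv_pow_integrand_ge0.
- exact: measurable_Lv_pow.
rewrite -ge0_integralZl//; last 2 first.
- by apply: emeasurable_funD; exact: measurable_Lv_pow.
- by move=> x Dx; rewrite adde_ge0// Lv_pow_integrand_ge0.
apply: ge0_le_integral => //.
- exact: Lv_pow_integrand_ge0.
- exact: measurable_Lv_pow.
- by apply: measurable_funeM; apply: emeasurable_funD; exact: measurable_Lv_pow.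
move=> x Dx; rewrite -EFinD -EFinM lee_fin -mulrDl mulrA ler_wpM2r ?v0//.
apply: le_trans (powR_add_le r0 _ _) => //.
by rewrite ge0_ler_powR// ?nnegrE ?addr_ge0//; exact: kgh.
Qed.

Lemma Lv_pow_interpolation p q r e : 0 < p -> 0 < q -> q < r -> 0 < e ->
  exists2 C, 0 <= C & forall g, measurable_fun D g ->
    (Lv_pow q g <= e%:E * (\int[mu]_(x in D) (v x)%:E + Lv_pow r g)
                   + C%:E * Lv_pow p g)%E.
Proof.
move=> p0 q0 qr e0; have [C C0 HC] := powR_interpolation p0 q0 qr e0.
exists C => // g mg.
have mv' : measurable_fun D (fun x => (v x)%:E) by exact/measurable_EFinP.
have v0' x : D x -> (0 <= (v x)%:E)%E by move=> Dx; rewrite lee_fin v0.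
rewrite /Lv_pow -ge0_integralD//; last 2 first.
- exact: Lv_pow_integrand_ge0.
- exact: measurable_Lv_pow.
have mI r' : measurable_fun D (fun x => (`|g x| `^ r' * v x)%:E).
  exact: measurable_Lv_pow.
have I0 r' x : D x -> (0 <= (`|g x| `^ r' * v x)%:E)%E.
  exact: Lv_pow_integrand_ge0.
rewrite -ge0_integralZl//; last 3 first.
- by apply: emeasurable_funD => //.
- by move=> x Dx; rewrite adde_ge0// ?v0' ?I0.
- by rewrite lee_fin ltW.
rewrite -ge0_integralZl//; last by move=> x Dx; exact: I0.
rewrite -ge0_integralD//; last 4 first.
- by move=> x Dx; rewrite mule_ge0 ?adde_ge0// ?v0' ?I0// lee_fin ltW.
- by apply: measurable_funeM; apply: emeasurable_funD.
- by move=> x Dx; rewrite mule_ge0 ?I0.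
- by apply: measurable_funeM.
apply: ge0_le_integral => //.
- exact: I0.
- apply: emeasurable_funD; apply: measurable_funeM => //.
  by apply: emeasurable_funD.
move=> x Dx; rewrite [leRHS](_ : _ =
  ((e * (1 + `|g x| `^ r) + C * `|g x| `^ p) * v x)%:E); last first.
  by rewrite [in RHS]mulrDl -!mulrA [in RHS]mulrDl mul1r.
by rewrite lee_fin ler_wpM2r ?v0// HC.
Qed.

(** With c = min (|a - b|, t) one has min (a, t) <= b + c, and c <= t gives
    c `^ r <= t `^ (r - p) * |a - b| `^ p. *)
Let minr_powR p r t a b : 0 < p -> p <= r -> 0 <= a -> 0 <= b -> 0 <= t ->
  Num.min a t `^ r <= 2 `^ r * (b `^ r + t `^ (r - p) * `|a - b| `^ p).
Proof.
move=> p0 pr a0 b0 t0.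
have r0 : 0 < r by exact: lt_le_trans pr.
pose c : R := Num.min `|a - b| t.
have c0 : 0 <= c by rewrite le_min normr_ge0.
have h1 : Num.min a t <= b + c.
  rewrite /c; have [ct|tc] := leP `|a - b| t.
    by rewrite ge_min -lerBlDl ler_norm.
  by rewrite ge_min lerDr b0 orbT.
apply: (@le_trans _ _ ((b + c) `^ r)).
  by rewrite ge0_ler_powR ?nnegrE ?le_min ?a0 ?addr_ge0// ltW.
apply: (le_trans (powR_add_le (ltW r0) b0 c0)).
rewrite ler_wpM2l ?powR_ge0// lerD2l.
have [->|cN] := eqVneq c 0.
  by rewrite powR0 ?gt_eqF// mulr_ge0 ?powR_ge0.
have -> : c `^ r = c `^ (r - p) * c `^ p.
  by rewrite -powRD ?subrK// cN implybT.
rewrite ler_pM ?powR_ge0// ge0_ler_powR ?nnegrE ?subr_ge0//; last first.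
- by rewrite /c ge_min lexx.
- exact: ltW.
- by rewrite /c ge_min lexx orbT.
Qed.

(** Boundedness in L^r_v passes to limits in L^p_v. The truncation of g at
    height n is controlled by [minr_powR], where the second term tends to 0
    with the L^p_v distance for fixed n; then n tends to infinity by monotone
    convergence. *)
Lemma Lv_pow_limit_le p r (g_ : nat -> T -> R) g (B : R) : 0 < p -> p <= r ->
  (forall j, measurable_fun D (g_ j)) -> measurable_fun D g ->
  (forall e, 0 < e -> exists j,
     (Lv_pow p (g_ j \- g)%R <= e%:E)%E /\ (Lv_pow r (g_ j) <= B%:E)%E) ->
  (Lv_pow r g <= (2 `^ r * B)%:E)%E.
Proof.
move=> p0 pr mg_ mg H.
have r0 : 0 < r by exact: lt_le_trans pr.
pose tr n x : R := Num.min `|g x| n%:R.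
have mtr n : measurable_fun D (tr n).
  apply: measurable_minr => //.
  exact: (measurableT_comp (@normr_measurable _ setT)).
have mI n : measurable_fun D (fun x => (tr n x `^ r * v x)%:E).
  apply/measurable_EFinP; apply: measurable_funM => //.
  exact: (measurableT_comp (measurable_powR r)).
have I0 n x : D x -> (0 <= (tr n x `^ r * v x)%:E)%E.
  by move=> Dx; rewrite lee_fin mulr_ge0 ?powR_ge0 ?v0.
have tr_nd m n x : (m <= n)%N -> tr m x `^ r <= tr n x `^ r.
  move=> mn; have tr0 k : 0 <= tr k x by rewrite le_min normr_ge0 ler0n.
  rewrite ge0_ler_powR ?nnegrE//; first exact: ltW.
  by rewrite le_min !ge_min lexx /= ler_nat mn orbT.
have trle n : (\int[mu]_(x in D) (tr n x `^ r * v x)%:E <= (2 `^ r * B)%:E)%E.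
  apply/lee_addgt0Pr => e e0.
  pose c := 2 `^ r * n%:R `^ (r - p).
  have c0 : 0 <= c by rewrite mulr_ge0 ?powR_ge0.
  have [j [je jB]] := H (e / (c + 1)) (divr_gt0 e0 (ltr_wpDl c0 ltr01)).
  apply: (@le_trans _ _ ((2 `^ r)%:E * Lv_pow r (g_ j)
                         + c%:E * Lv_pow p (g_ j \- g)%R)%E).
    rewrite /Lv_pow -ge0_integralZl//; last 2 first.
    - exact: measurable_Lv_pow.
    - exact: Lv_pow_integrand_ge0.
    have mB : measurable_fun D (g_ j \- g) by exact: measurable_funB.
    rewrite -ge0_integralZl//; last 2 first.
    - exact: measurable_Lv_pow.
    - exact: Lv_pow_integrand_ge0.
    rewrite -ge0_integralD//; last 4 first.
    - move=> x Dx; rewrite mule_ge0 ?lee_fin ?powR_ge0//.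
      by have := Lv_pow_integrand_ge0 r (g_ j) Dx; rewrite lee_fin.
    - by apply: measurable_funeM; exact: measurable_Lv_pow.
    - move=> x Dx; rewrite mule_ge0 ?lee_fin//.
      by have := Lv_pow_integrand_ge0 p (g_ j \- g) Dx; rewrite lee_fin.
    - by apply: measurable_funeM; exact: measurable_Lv_pow.
    apply: ge0_le_integral => //.
    - exact: I0.
    - by apply: emeasurable_funD; apply: measurable_funeM;
        exact: measurable_Lv_pow.
    move=> x Dx; rewrite -!EFinM -EFinD lee_fin !mulrA -mulrDl.
    rewrite ler_wpM2r ?v0// /c -mulrA -mulrDr.
    apply: (le_trans (minr_powR p0 pr _ (normr_ge0 (g_ j x)) _)) => //.
    rewrite ler_wpM2l ?powR_ge0// lerD2l ler_wpM2l ?powR_ge0//.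
    rewrite ge0_ler_powR ?nnegrE//; first exact: ltW.
    by rewrite distrC; exact: ler_dist_dist.
  apply: leeD.
    by rewrite EFinM lee_wpmul2l// lee_fin powR_ge0.
  apply: (@le_trans _ _ (c%:E * (e / (c + 1))%:E)%E).
    by rewrite lee_wpmul2l.
  rewrite -EFinM lee_fin mulrCA ler_piMr//; first exact: ltW.
  by rewrite ler_pdivrMr ?mul1r ?lerDl// ltr_wpDl.
rewrite /Lv_pow.
rewrite (_ : (\int[mu]_(x in D) (`|g x| `^ r * v x)%:E)%E =
  (\int[mu]_(x in D) limn (fun n => (tr n x `^ r * v x)%:E))%E); last first.
  apply: eq_integral => x _; apply/esym; apply: lim_near_cst => //.
  have [N gN] : exists N : nat, `|g x| <= N%:R.
    by exists (Num.truncn `|g x|).+1; rewrite ltW// truncnS_gt.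
  exists N => // n /= Nn; rewrite /tr min_l//.
  by rewrite (le_trans gN)// ler_nat.
rewrite monotone_convergence//; last first.
  move=> x Dx m n mn; rewrite lee_fin ler_wpM2r ?v0//.
  exact: tr_nd.
apply: lime_le; last by apply: nearW => n; exact: trle.
apply: ereal_nondecreasing_is_cvgn => m n mn; apply: ge0_le_integral => //.
  exact: I0.
move=> x Dx; rewrite lee_fin ler_wpM2r ?v0//.
exact: tr_nd.
Qed.

(** In [Lv_pow_interpolation] the first term is small by the choice of its
    coefficient and the bounds V and B, the second by the choice of delta. The
    exponents p and q may be in any order. *)
Lemma Lv_pow_small p q r (V B e : R) : 0 < p -> 0 < q -> q < r -> 0 <= B ->
  (\int[mu]_(x in D) (v x)%:E <= V%:E)%E -> 0 < e ->
  exists2 delta, 0 < delta & forall g, measurable_fun D g ->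
    (Lv_pow r g <= B%:E)%E -> (Lv_pow p g <= delta%:E)%E ->
    (Lv_pow q g <= e%:E)%E.
Proof.
move=> p0 q0 qr B0 vV e0.
have V0 : 0 <= V by rewrite -lee_fin (le_trans integral_v_ge0).
have VB : 0 < V + B + 1 by rewrite ltr_wpDl// addr_ge0.
have eta0 : 0 < e / 2 / (V + B + 1) by rewrite !divr_gt0.
have [C C0 HC] := Lv_pow_interpolation p0 q0 qr eta0.
have C1 : 0 < C + 1 by rewrite ltr_wpDl.
exists (e / 2 / (C + 1)); first by rewrite !divr_gt0.
move=> g mg gB gd; apply: (le_trans (HC _ mg)).
have -> : e%:E = ((e / 2)%:E + (e / 2)%:E)%E by rewrite -EFinD -splitr.
apply: leeD.
  apply: (@le_trans _ _ ((e / 2 / (V + B + 1))%:E * (V%:E + B%:E))%E).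
    by rewrite lee_wpmul2l ?lee_fin ?leeD// ltW.
  rewrite -EFinD -EFinM lee_fin mulrAC ler_pdivrMr// ler_wpM2l ?lerDl//.
  by rewrite ltW// divr_gt0.
apply: (@le_trans _ _ (C%:E * (e / 2 / (C + 1))%:E)%E).
  by rewrite lee_wpmul2l.
rewrite -EFinM lee_fin mulrCA ler_piMr ?ler_pdivrMr ?mul1r ?lerDl//.
by rewrite ltW// divr_gt0.
Qed.

Let half m : R := 2^-1 ^+ m.

Let half_ge0 m : 0 <= half m.
Proof. by rewrite exprn_ge0// invr_ge0. Qed.

Let half_small e : 0 < e -> exists m, half m <= e.
Proof.
move=> e0; exists (Num.truncn e^-1).+1; rewrite /half exprVn invf_ple ?posrE//.
apply: (le_trans (ltW (truncnS_gt _))).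
by rewrite -natrX ler_nat ltnW// ltn_expl.
Qed.

Let sum_half m n : \sum_(i < n) half (m + i).+1 <= half m.
Proof.
suff -> : \sum_(i < n) half (m + i).+1 = half m - half (m + n).
  by rewrite lerBlDr lerDl.
elim: n => [|n IH]; first by rewrite big_ord0 addn0 subrr.
rewrite big_ord_recr /= IH /half addnS exprS.
rewrite -addrA; congr (_ + _); rewrite [X in - X + _](splitr _).
by rewrite opprD [_ / 2]mulrC addrNK.
Qed.

(** For a sequence with summable increments in L^1_v, the integrable function
    [tail] m dominates |u k - u m| * v for all k >= m. Hence u converges almost
    everywhere where v > 0, and the same function controls the distance to the
    limit. *)
Section fast_sequences.
Variable u : nat -> T -> R.
Hypothesis mu_ : forall m, measurable_fun D (u m).
Hypothesis fast : forall m,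
  (Lv_pow 1 (u m.+1 \- u m)%R <= (half m.+1)%:E)%E.

Let diff m x : \bar R := (`|u m.+1 x - u m x| `^ 1 * v x)%:E.
Let tail m x : \bar R := (\sum_(i <oo) diff (m + i) x)%E.

Let mdiff m : measurable_fun D (diff m).
Proof. by apply: measurable_Lv_pow; exact: measurable_funB. Qed.

Let diff0 m x : D x -> (0 <= diff m x)%E.
Proof. exact: (@Lv_pow_integrand_ge0 1 (u m.+1 \- u m)). Qed.

Let integral_tail m : (\int[mu]_(x in D) tail m x <= (half m)%:E)%E.
Proof.
rewrite integral_nneseries//; last by move=> n x Dx; exact: diff0.
apply: lime_le.
  by apply: is_cvg_nneseries => n _ _; apply: integral_ge0 => x; exact: diff0.
apply: nearW => n; rewrite big_mkord.
apply: (@le_trans _ _ (\sum_(i < n) (half (m + i).+1)%:E)%E).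
  by apply: lee_sum => i _; exact: fast.
by rewrite sumEFin lee_fin sum_half.
Qed.

Let measurable_tail m : measurable_fun D (tail m).
Proof.
apply: ge0_emeasurable_sum => [k x Dx _|k _]; [exact: diff0|exact: mdiff].
Qed.

Let tail_ge m n x : D x ->
  ((`|u (m + n)%N x - u m x| * v x)%:E <= tail m x)%E.
Proof.
move=> Dx.
have h : ((`|u (m + n)%N x - u m x| * v x)%:E <= \sum_(i < n) diff (m + i) x)%E.
  elim: n => [|n IH].
    by rewrite big_ord0 addn0 subrr normr0 mul0r.
  rewrite big_ord_recr /=; apply: (le_trans _ (leeD2r _ IH)).
  rewrite /diff -EFinD lee_fin -mulrDl ler_wpM2r ?v0// powRr1//.
  rewrite addnS addrC [leRHS]addrC; apply: (le_trans _ (ler_normD _ _)).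
  by rewrite addrA subrK addrC.
apply: (le_trans h); rewrite -(big_mkord xpredT (fun i => diff (m + i) x)).
by apply: nneseries_lim_ge => i _ _; exact: diff0.
Qed.

(** Defining w as an upper limit makes it measurable on the whole of D; where the
    sequence diverges and v > 0, [tail] is infinite, and where v = 0 the
    integrand vanishes. *)
Lemma fast_Lv_cauchy_limit :
  exists w, measurable_fun D w /\
    forall m, (Lv_pow 1 (u m \- w)%R <= (half m)%:E)%E.
Proof.
pose w x := fine (limn_esup (fun m => (u m x)%:E)).
have mw : measurable_fun D w.
  apply: (measurableT_comp (@fine_measurable R setT measurableT)) => //.
  by apply: measurable_fun_limn_esup => n; exact/measurable_EFinP.
exists w; split=> // m; apply: le_trans (integral_tail m).
apply: ae_ge0_le_integral => //.
- exact: Lv_pow_integrand_ge0.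
- by apply: measurable_Lv_pow; exact: measurable_funB.
- by move=> x Dx; apply: nneseries_ge0 => n _ _; exact: diff0.
have tail_int : mu.-integrable D (tail 0).
  apply/integrableP; split=> //.
  under eq_integral => x xD.
    rewrite gee0_abs; last first.
      by apply: nneseries_ge0 => n _ _; apply: diff0; exact: set_mem.
    over.
  by rewrite (le_lt_trans (integral_tail 0))// ltry.
have := integrable_ae mD tail_int; apply: filterS => x + Dx => /(_ Dx) tfin.
have := v0 Dx; rewrite le_eqVlt => /predU1P[v00|vx].
  rewrite -v00 mulr0; apply: nneseries_ge0 => n _ _; exact: diff0.
have [l ul] : exists l : R, u n x @[n --> \oo] --> l.
  pose t := telescope (u ^~ x).
  have ct : cvgn (series t).
    apply: normed_cvg; apply: nondecreasing_is_cvgn.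
      apply/nondecreasing_seqP => n.
      by rewrite [leRHS]seriesSr lerDl normr_ge0.
    exists (fine (tail 0 x) / v x) => _ [n _ <-].
    rewrite ler_pdivlMr// -lee_fin fineK//.
    apply: (@le_trans _ _ (\sum_(0 <= i < n) diff (0 + i) x)%E).
      rewrite /series /= mulr_suml sumEFin lee_fin ler_sum// => i _.
      by rewrite powRr1.
    by apply: nneseries_lim_ge => i _ _; exact: diff0.
  exists (limn (series t) + u 0%N x).
  rewrite (_ : (fun n => u n x) = series t \+ cst (u 0%N x)); last first.
    by apply/funext => n /=; rewrite [LHS](eq_sum_telescope (u^~ x)) addrC.
  by apply: cvgD => //; exact: cvg_cst.
have wl : w x = l.
  have : (u n x)%:E @[n --> \oo] --> l%:E by apply: cvg_EFin => //; exact: nearW.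
  by move/cvg_limn_einf_sup => [_ h]; rewrite /w h.
have cm : (`|u (m + n)%N x - u m x| * v x)%:E @[n --> \oo]
    --> (`|w x - u m x| * v x)%:E.
  apply: cvg_EFin; first exact: nearW.
  apply: cvgM; last exact: cvg_cst.
  apply: cvg_norm; apply: cvgB; last exact: cvg_cst.
  rewrite wl; under eq_fun do rewrite addnC.
  by move: ul; rewrite -(cvg_shiftn m).
rewrite powRr1// distrC -(cvg_lim _ cm)//; apply: lime_le.
  by apply/cvg_ex; exists (`|w x - u m x| * v x)%:E.
by apply: nearW => n; exact: tail_ge.
Qed.

End fast_sequences.

(** Completeness of L^1_v, through a subsequence with increments 2^-m. *)
Lemma Lv_complete (u : nat -> T -> R) : (forall m, measurable_fun D (u m)) ->
  (forall e, 0 < e -> exists N, forall k l, (N <= k)%N -> (N <= l)%N ->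
     (Lv_pow 1 (u k \- u l)%R <= e%:E)%E) ->
  exists2 w, measurable_fun D w & forall e, 0 < e -> exists N, forall k,
    (N <= k)%N -> (Lv_pow 1 (u k \- w)%R <= e%:E)%E.
Proof.
move=> mu_ H.
have half_gt0 m : 0 < half m by rewrite exprn_gt0.
have /choice[N HN] m := H _ (half_gt0 m.+1).
pose psi m := \max_(i < m.+1) N i.
have Npsi m n : (m <= n)%N -> (N m <= psi n)%N.
  rewrite -ltnS => mn.
  exact: (@leq_bigmax_cond _ xpredT (fun i : 'I_n.+1 => N i) (Ordinal mn)).
have [w [mw Hw]] := @fast_Lv_cauchy_limit (fun m => u (psi m))
  (fun m => mu_ _) (fun m => HN m _ _ (Npsi _ _ (leqnSn m)) (Npsi _ _ (leqnn m))).
exists w => // e e0; have [m me] := half_small (divr_gt0 e0 (ltr0n R 4)).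
exists (N m) => k Nk.
have mB (f g : T -> R) : measurable_fun D f -> measurable_fun D g ->
  measurable_fun D (f \- g) by exact: measurable_funB.
apply: (le_trans (@Lv_powD_le 1 (u k \- u (psi m)) (u (psi m) \- w) _ ler01
  (mB _ _ (mu_ _) (mu_ _)) (mB _ _ (mu_ _) mw) (mB _ _ (mu_ _) mw) _)).
  by move=> x _ /=; apply: (le_trans _ (ler_normD _ _)); rewrite addrA subrK.
apply: (@le_trans _ _ ((2 `^ 1)%:E * ((half m.+1)%:E + (half m)%:E))%E).
  rewrite lee_wpmul2l// ?lee_fin ?powR_ge0// leeD//.
  exact: HN (Npsi _ _ (leqnn m)).
rewrite -EFinD -EFinM lee_fin powRr1//.
have : half m.+1 <= half m.
  by rewrite /half exprS ler_piMl// invf_le1// ler1n.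
move=> h; apply: (@le_trans _ _ (2 * (half m + half m))).
  by rewrite ler_wpM2l// lerD2r.
by lra.
Qed.

(** By [Lv_pow_small] the sequence is Cauchy in L^1_v, hence has a limit w there
    ([Lv_complete]); w belongs to L^r_v by [Lv_pow_limit_le], and a second use of
    [Lv_pow_small], between the exponents 1 and r, gives convergence in L^q_v.
    The detour through L^1_v makes the argument uniform in p and q, which may be
    in any order. *)
Lemma Lv_cauchy_limit p q r (V B : R) (u : nat -> T -> R) :
  0 < p -> 0 < q -> q < r -> 1 < r ->
  (\int[mu]_(x in D) (v x)%:E <= V%:E)%E ->
  (forall m, measurable_fun D (u m)) ->
  (forall m, (Lv_pow r (u m) <= B%:E)%E) ->
  (forall e, 0 < e -> exists N, forall k l, (N <= k)%N -> (N <= l)%N ->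
     (Lv_pow p (u k \- u l)%R <= e%:E)%E) ->
  exists w, [/\ measurable_fun D w, (Lv_pow r w <= (2 `^ r * B)%:E)%E &
    forall e, 0 < e -> exists N, forall k, (N <= k)%N ->
      (Lv_pow q (u k \- w)%R <= e%:E)%E].
Proof.
move=> p0 q0 qr r1 vV mu_ uB H.
have r0 : 0 < r by exact: lt_trans r1.
have B0 : 0 <= B by rewrite -lee_fin (le_trans (Lv_pow_ge0 r (u 0%N))).
have mB (f g : T -> R) : measurable_fun D f -> measurable_fun D g ->
  measurable_fun D (f \- g) by exact: measurable_funB.
have powB (f g : T -> R) b c : measurable_fun D f -> measurable_fun D g ->
    (Lv_pow r f <= b%:E)%E -> (Lv_pow r g <= c%:E)%E ->
    (Lv_pow r (f \- g)%R <= (2 `^ r * (b + c))%:E)%E.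
  move=> mf mg fb gc; apply: (le_trans (@Lv_powD_le r f g _ (ltW r0) mf mg _ _)).
  - exact: mB.
  - by move=> x _ /=; rewrite (le_trans (ler_normB _ _)).
  - by rewrite EFinM EFinD lee_wpmul2l ?leeD// lee_fin powR_ge0.
have [e e0|w mw Hw] := @Lv_complete u mu_.
  have [|dl dl0 Hd] := @Lv_pow_small p 1 r V (2 `^ r * (B + B)) e p0 ltr01 r1 _ vV e0.
    by rewrite mulr_ge0 ?powR_ge0// addr_ge0.
  have [N HN] := H _ dl0; exists N => k l Nk Nl; apply: Hd; first exact: mB.
    exact: powB.
  exact: HN.
have wB : (Lv_pow r w <= (2 `^ r * B)%:E)%E.
  apply: (@Lv_pow_limit_le 1 r u w B ltr01 (ltW r1)) => // e e0.
  by have [N HN] := Hw _ e0; exists N; split=> //; exact: HN.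
exists w; split; [exact: mw|exact: wB|move=> e e0].
have [|dl dl0 Hd] :=
  @Lv_pow_small 1 q r V (2 `^ r * (B + 2 `^ r * B)) e ltr01 q0 qr _ vV e0.
  by rewrite mulr_ge0 ?powR_ge0// addr_ge0// mulr_ge0// powR_ge0.
have [N HN] := Hw _ dl0; exists N => k Nk; apply: Hd; first exact: mB.
  exact: powB.
exact: HN.
Qed.

End weighted_powers.

Section weighted_power_sums.
Context d (T : measurableType d) (R : realType) (mu : {measure set T -> \bar R}).
Variables (D : set T) (mD : measurable D) (v : T -> R).
Hypothesis mv : measurable_fun D v.
Hypothesis v0 : forall x, D x -> 0 <= v x.

Lemma Lv_powD3_le (r : R) (f g h k : T -> R) : 0 <= r ->
  measurable_fun D f -> measurable_fun D g -> measurable_fun D h ->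
  measurable_fun D k ->
  (forall x, D x -> `|k x| <= `|f x| + `|g x| + `|h x|) ->
  (Lv_pow mu D v r k <=
    (4 `^ r)%:E * (Lv_pow mu D v r f + Lv_pow mu D v r g + Lv_pow mu D v r h))%E.
Proof.
move=> r0 mf mg mh mk kfgh.
have mI (f' : T -> R) : measurable_fun D f' ->
    measurable_fun D (fun x => (`|f' x| `^ r * v x)%:E).
  exact: measurable_Lv_pow.
have I0 (f' : T -> R) x : D x -> (0 <= (`|f' x| `^ r * v x)%:E)%E.
  by move=> Dx; rewrite lee_fin mulr_ge0 ?powR_ge0 ?v0.
rewrite /Lv_pow -ge0_integralD//; [|exact: I0|exact: mI|exact: I0|exact: mI].
rewrite -ge0_integralD//; last 4 first.
- by move=> x Dx; rewrite adde_ge0 ?I0.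
- by apply: emeasurable_funD; exact: mI.
- exact: I0.
- exact: mI.
have mS : measurable_fun D (fun x => ((`|f x| `^ r * v x)%:E
    + (`|g x| `^ r * v x)%:E + (`|h x| `^ r * v x)%:E)%E).
  by apply: emeasurable_funD; [apply: emeasurable_funD|]; exact: mI.
rewrite -ge0_integralZl//; last first.
  by move=> x Dx; rewrite !adde_ge0 ?I0.
apply: ge0_le_integral => //; [exact: I0|exact: mI|exact: measurable_funeM|].
move=> x Dx; rewrite -!EFinD -EFinM lee_fin -!mulrDl mulrA ler_wpM2r ?v0//.
apply: le_trans (powR_add3_le r0 _ _ _); rewrite ?normr_ge0//.
by rewrite ge0_ler_powR ?nnegrE ?addr_ge0//; exact: kfgh.
Qed.

Lemma Lv_pow_cst_le (r c V : R) : (\int[mu]_(x in D) (v x)%:E <= V%:E)%E ->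
  (Lv_pow mu D v r (fun=> c) <= (`|c| `^ r * V)%:E)%E.
Proof.
move=> vV; rewrite /Lv_pow; under eq_integral do rewrite EFinM.
have mv' : measurable_fun D (fun x => (v x)%:E) by exact/measurable_EFinP.
rewrite ge0_integralZl//.
by rewrite [leRHS]EFinM lee_wpmul2l// lee_fin powR_ge0.
Qed.

Lemma integral_cover_le (I : choiceType) (l : seq I) (B : I -> set T) (h : T -> \bar R) :
  (forall i, i \in l -> measurable (B i)) -> measurable_fun D h ->
  (forall x, D x -> (0 <= h x)%E) ->
  (forall x, D x -> exists2 i, i \in l & B i x) ->
  (\int[mu]_(x in D) h x <= \sum_(i <- l) \int[mu]_(x in D `&` B i) h x)%E.
Proof.
move=> mB mh h0 cov; have {1}-> : D = D `&` \big[setU/set0]_(i <- l) B i.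
  apply/seteqP; split=> [x Dx|x []//]; split=> //.
  by have [i il Bx] := cov x Dx; rewrite -bigcup_seq; exists i.
elim: l mB {cov} => [|i l IH] mB; first by rewrite !big_nil setI0 integral_set0.
have mBl j : j \in l -> measurable (B j).
  by move=> jl; apply: mB; rewrite inE jl orbT.
rewrite !big_cons setIUr; apply: le_trans (leeD2l _ (IH mBl)).
have mU : measurable (\big[setU/set0]_(j <- l) B j).
  by rewrite big_seq; exact: bigsetU_measurable.
have mBi : measurable (B i) by apply: mB; rewrite mem_head.
apply: ge0_integral_setU_le; [exact: measurableI|exact: measurableI| |].
- by apply: measurable_funS mh => // x [|] [].
- by move=> x [|] [Dx _]; exact: h0.
Qed.

End weighted_power_sums.

Section poweR_inverse.
Context {R : realType}.

Lemma poweR_inv_le (X : \bar R) (c r : R) : (0 <= X)%E -> 0 < r -> 0 <= c ->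
  (X `^ r^-1 <= c%:E)%E <-> (X <= (c `^ r)%:E)%E.
Proof.
move=> X0 r0 c0; split=> h.
  have -> : X = ((X `^ r^-1) `^ r)%E.
    by rewrite -poweRrM mulVf ?poweRe1// gt_eqF.
  rewrite -poweR_EFin; apply: gt0_ler_poweR => //; first exact: ltW.
    by rewrite in_itv /= poweR_ge0 leey.
  by rewrite in_itv /= lee_fin c0 leey.
have -> : c%:E = ((c `^ r)%:E `^ r^-1)%E.
  by rewrite poweR_EFin -powRrM mulfV ?powRr1// gt_eqF.
apply: gt0_ler_poweR => //; first by rewrite invr_ge0 ltW.
  by rewrite in_itv /= X0 leey.
by rewrite in_itv /= lee_fin powR_ge0 leey.
Qed.

End poweR_inverse.

Lemma cvge0_le {R : realType} (a : nat -> \bar R) : (forall j, (0 <= a j)%E) ->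
  (forall e : R, 0 < e -> exists N, forall j, (N <= j)%N -> (a j <= e%:E)%E) ->
  a j @[j --> \oo] --> 0%E.
Proof.
move=> a0 H; apply/fine_cvgP; split.
  have [N HN] := H 1 ltr01; exists N => // j /= Nj.
  by rewrite ge0_fin_numE// (le_lt_trans (HN _ Nj))// ltry.
apply/cvgrPdist_le => e e0; have [N HN] := H e e0; exists N => // j /= Nj.
rewrite sub0r normrN ger0_norm ?fine_ge0// -lee_fin fineK ?HN//.
by rewrite ge0_fin_numE// (le_lt_trans (HN _ Nj))// ltry.
Qed.

(** * Compactness and extraction of subsequences *)

(** If P does not hold for K, then the sets A such that P (K `\` A) form a proper
    filter containing K; it would have a cluster point in K, where P holds
    locally. This form of compactness replaces finite subcovers: the data that
    belong to the finitely many pieces are combined inside P. *)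
Lemma compact_induction (T : topologicalType) (K : set T) (P : set T -> Prop) :
  compact K -> P set0 ->
  (forall A B, P A -> P B -> P (A `|` B)) ->
  (forall A B, A `<=` B -> P B -> P A) ->
  (forall x, K x -> exists2 U, nbhs x U & P U) -> P K.
Proof.
move=> cK P0 PU PS Pn; apply: contrapT => PK.
pose F : set_system T := [set A | P (K `\` A)].
have FF : ProperFilter F.
  constructor; first by rewrite /F /= setD0.
  constructor.
  - by rewrite /F /= setDT.
  - by move=> A B FA FB; rewrite /F /= setDIr; exact: PU.
  - by move=> A B AB; apply: PS; exact: setDS.
have [|x [Kx xF]] := cK F FF; first by rewrite /F /= setDv.
have [U xU PUx] := Pn x Kx.
have [|y [nUy Uy]] := xF (~` U) U _ xU; last exact: nUy.
by apply: PS PUx => y [_ /contrapT].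
Qed.

Section ultrafilter_extraction.
Context {R : realType}.

Lemma ultrafilter_bounded_cauchy (U : set_system nat) (a : nat -> R) (b e : R) :
  UltraFilter U -> (forall j, `|a j| <= b) -> 0 < e ->
  exists2 A, U A & forall j k, A j -> A k -> `|a j - a k| <= e.
Proof.
move=> UU ab e0.
have aUab : (a @ U) `[- b, b]%classic.
  apply: (@filterE _ U _ (a @^-1` `[- b, b])) => j.
  by rewrite /= in_itv /= -ler_norml; exact: ab.
have [l [_ al]] := @segment_compact R (- b) b (a @ U) _ aUab.
have e2 : 0 < e / 2 by rewrite divr_gt0.
exists (a @^-1` ball l (e / 2)).
  have [//|nU] := in_ultra_setVsetC (a @^-1` ball l (e / 2)) UU.
  by have [x []] := al (~` ball l (e / 2)) _ nU (nbhsx_ballx l _ e2).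
move=> j k; rewrite /= -ball_normE /= => lj lk.
have -> : a j - a k = (l - a k) - (l - a j) by ring.
by rewrite (le_trans (ler_normB _ _))// (splitr e) lerD// ltW.
Qed.

Lemma ultrafilter_finite_cauchy (U : set_system nat) (I : Type) (s : seq I)
    (a : I -> nat -> R) (p e : R) :
  UltraFilter U -> 0 < p -> (forall i, exists b, forall j, `|a i j| <= b) ->
  0 < e -> exists2 A, U A & forall j k, A j -> A k ->
    \sum_(i <- s) `|a i j - a i k| `^ p <= e.
Proof.
move=> UU p0 ab; elim: s e => [|i s IH] e e0.
  exists setT; first exact: filterT.
  by move=> j k _ _; rewrite big_nil ltW.
have e2 : 0 < e / 2 by rewrite divr_gt0.
have [A UA HA] := IH _ e2; have [b Hb] := ab i.
have d0 : 0 < (e / 2) `^ p^-1 by exact: powR_gt0.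
have [B UB HB] := ultrafilter_bounded_cauchy UU Hb d0.
exists (A `&` B); first exact: filterI.
move=> j k [Aj Bj] [Ak Bk]; rewrite big_cons (splitr e) lerD ?HA//.
have -> : e / 2 = ((e / 2) `^ p^-1) `^ p.
  by rewrite -powRrM mulVf ?gt_eqF// powRr1// ltW.
rewrite ge0_ler_powR ?nnegrE ?powR_ge0 ?normr_ge0 ?HB//; exact: ltW.
Qed.

(** If for each e the distance d j k is controlled, up to e, by finitely many
    bounded sequences, then some subsequence is Cauchy for d. A free ultrafilter
    on the indices makes all bounded sequences converge at once, so that no
    successive extractions are needed: for each m there is a set A m of the
    ultrafilter on which d is at most 1/(m+1), and the subsequence picks its m-th
    index in A 0, ..., A m. *)
Lemma totally_bounded_cauchy_subsequence (d : nat -> nat -> \bar R) (p : R) :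
  0 < p ->
  (forall e : R, 0 < e -> exists (I : Type) (s : seq I) (a : I -> nat -> R) (c : R),
    [/\ 0 <= c, forall i, exists b, forall j, `|a i j| <= b &
      forall j k, (d j k <=
        (e + c * \sum_(i <- s) `|a i j - a i k| `^ p)%:E)%E]) ->
  exists phi : nat -> nat, {homo phi : i j / (i < j)%N >-> (i < j)%N} /\
    forall e : R, 0 < e -> exists N, forall j k, (N <= j)%N -> (N <= k)%N ->
      (d (phi j) (phi k) <= e%:E)%E.
Proof.
move=> p0 H.
(* An ultrafilter containing the cofinite sets meets every A m in
   arbitrarily large indices. *)
have [U [UU ooU]] := @ultraFilterLemma nat \oo _.
have small (e : R) : 0 < e ->
    exists A, U A /\ forall j k, A j -> A k -> (d j k <= e%:E)%E.
  move=> e0; have e2 : 0 < e / 2 by rewrite divr_gt0.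
  have [I [s [a [c [c0 ab Hd]]]]] := H _ e2.
  have c1 : 0 < c + 1 by rewrite ltr_wpDl.
  have [A UA HA] := ultrafilter_finite_cauchy s UU p0 ab (divr_gt0 e2 c1).
  exists A; split=> // j k Aj Ak; apply: (le_trans (Hd j k)).
  rewrite lee_fin [leRHS](splitr e) lerD2l.
  apply: (@le_trans _ _ (c * (e / 2 / (c + 1)))).
    by rewrite ler_wpM2l// HA.
  by rewrite mulrCA ler_piMr ?(ltW e2)// ler_pdivrMr// mul1r lerDl.
have /choice[A HA] m : exists A, U A /\
    forall j k, A j -> A k -> (d j k <= (m.+1%:R^-1)%:E)%E.
  by apply: small; rewrite invr_gt0.
pose B m := \bigcap_(i in `I_m.+1) A i.
have UB m : U (B m).
  rewrite /B bigcap_mkord; elim/big_ind : _ => [||i _]; first exact: filterT.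
    by move=> X Y; exact: filterI.
  by have [] := HA i.
have /choice[next Hnext] (mn : nat * nat) : exists k, B mn.1 k /\ (mn.2 < k)%N.
  have [|k [Bk nk]] := @filter_ex _ U _ (B mn.1 `&` [set k | (mn.2 < k)%N]) _.
    apply: filterI; first exact: UB.
    by apply: ooU; exists mn.2.+1.
  by exists k.
pose phi := fix phi m := if m is m'.+1 then next (m, phi m') else next (0, 0)%N.
have phiB m : B m (phi m).
  by case: m => [|m] /=; [have [] := Hnext (0, 0)%N|have [] := Hnext (m.+1, phi m)].
exists phi; split.
  apply: homo_ltn; first exact: ltn_trans.
  by move=> m; have [_] := Hnext (m.+1, phi m).
move=> e e0; pose N := Num.truncn e^-1; exists N => j k Nj Nk.
apply: (@le_trans _ _ ((N.+1%:R^-1)%:E)).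
  have [_ HN] := HA N; apply: HN.
    by apply: (phiB j); rewrite /= ltnS.
  by apply: (phiB k); rewrite /= ltnS.
rewrite lee_fin invf_ple ?posrE//; exact/ltW/truncnS_gt.
Qed.

End ultrafilter_extraction.

(** * Euclidean norms and the square root of Q *)

Section euclidean_norm.
Context {R : realType} {n : nat}.
Implicit Types (a b xi w : 'rV[R]_n) (A S : 'M[R]_n).

Lemma sum_sqr_ge0 m (f : 'I_m -> R) : 0 <= \sum_i f i ^+ 2.
Proof. by apply: sumr_ge0 => i _; exact: sqr_ge0. Qed.

Lemma sqr_sum_mul_le m (f g : 'I_m -> R) :
  (\sum_i f i * g i) ^+ 2 <= (\sum_i f i ^+ 2) * (\sum_i g i ^+ 2).
Proof.
set a := \sum_i f i ^+ 2; set b := \sum_i g i ^+ 2; set s := \sum_i f i * g i.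
have a0 : 0 <= a by exact: sum_sqr_ge0.
have : 0 <= \sum_i (a * g i - s * f i) ^+ 2 by exact: sum_sqr_ge0.
have -> : \sum_i (a * g i - s * f i) ^+ 2 = a * (a * b - s ^+ 2).
  transitivity (\sum_i (a ^+ 2 * g i ^+ 2 - 2 * a * s * (f i * g i)
                        + s ^+ 2 * f i ^+ 2)).
    by apply: eq_bigr => i _; ring.
  rewrite big_split sumrB /= -!mulr_sumr -/a -/b -/s; ring.
have [a0'|] := eqVneq a 0.
  move=> _; have f0 i : f i = 0.
    apply/eqP; rewrite -sqrf_eq0; apply/eqP/(psumr_eq0P _ a0') => // j _.
    exact: sqr_ge0.
  by rewrite /s big1 ?expr0n ?mulr_ge0 ?sum_sqr_ge0// => i _; rewrite f0 mul0r.
move=> aN; rewrite pmulr_rge0 ?subr_ge0//.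
by rewrite lt_neqAle eq_sym aN.
Qed.

Lemma enorm_ge0 xi : 0 <= enorm xi.
Proof. exact: sqrtr_ge0. Qed.

Lemma sqr_enorm xi : enorm xi ^+ 2 = \sum_i xi 0 i ^+ 2.
Proof. by rewrite sqr_sqrtr// sum_sqr_ge0. Qed.

Lemma sum_mul_le_enorm a b : \sum_i a 0 i * b 0 i <= enorm a * enorm b.
Proof.
apply: (le_trans (ler_norm _)); rewrite -(@ler_pXn2r _ 2)// ?nnegrE//.
  by rewrite real_normK ?num_real// exprMn !sqr_enorm; exact: sqr_sum_mul_le.
by rewrite mulr_ge0 ?enorm_ge0.
Qed.

Lemma enormD_le a b : enorm (a + b) <= enorm a + enorm b.
Proof.
rewrite -(@ler_pXn2r _ 2)// ?nnegrE ?enorm_ge0 ?addr_ge0 ?enorm_ge0//.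
rewrite sqrrD !sqr_enorm.
have -> : \sum_i (a + b) 0 i ^+ 2 =
    \sum_i a 0 i ^+ 2 + (\sum_i a 0 i * b 0 i) *+ 2 + \sum_i b 0 i ^+ 2.
  rewrite -sumrMnl -!big_split /=; apply: eq_bigr => i _.
  by rewrite mxE sqrrD.
by rewrite lerD2r lerD2l lerMn2r /= sum_mul_le_enorm.
Qed.

Lemma enormZ c a : enorm (c *: a) = `|c| * enorm a.
Proof.
rewrite /enorm; under eq_bigr do rewrite mxE exprMn.
by rewrite -mulr_sumr sqrtrM ?sqr_ge0// sqrtr_sqr.
Qed.

Lemma enorm_eq0 a : enorm a = 0 -> a = 0.
Proof.
move=> a0; have := sqr_enorm a; rewrite a0 expr0n /= => /esym/psumr_eq0P h.
apply/rowP => i; rewrite mxE; apply/eqP; rewrite -sqrf_eq0; apply/eqP.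
by apply: h => // j _; exact: sqr_ge0.
Qed.

Lemma mulmxvD A a b : mulmxv A (a + b) = mulmxv A a + mulmxv A b.
Proof. exact: mulmxDl. Qed.

Lemma mulmxvZ A c a : mulmxv A (c *: a) = c *: mulmxv A a.
Proof. by rewrite /mulmxv scalemxAl. Qed.

(** The supremum that defines the operator norm is taken over a set bounded by the
    Hilbert-Schmidt norm of A, so it is an upper bound. *)
Lemma enorm_mulmxv_le A w : enorm (mulmxv A w) <= opnorm A * enorm w.
Proof.
have [/enorm_eq0 ->|w0] := eqVneq (enorm w) 0.
  rewrite /mulmxv mul0mx /enorm big1 ?sqrtr0 ?mulr0// => i _.
  by rewrite mxE expr0n.
have wp : 0 < enorm w by rewrite lt_neqAle eq_sym w0 enorm_ge0.
rewrite -ler_pdivrMr//.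
have -> : enorm (mulmxv A w) / enorm w = enorm (mulmxv A ((enorm w)^-1 *: w)).
  by rewrite mulmxvZ enormZ mulrC ger0_norm// invr_ge0 ltW.
apply: sup_ubound; last first.
  exists ((enorm w)^-1 *: w) => //=.
  by rewrite enormZ ger0_norm ?invr_ge0 ?(ltW wp)// mulVf.
pose B := \sum_i \sum_j A i j ^+ 2.
have B0 : 0 <= B by apply: sumr_ge0 => i _; exact: sum_sqr_ge0.
exists (Num.sqrt B) => _ [xi /= xi1 <-].
rewrite -(@ler_pXn2r _ 2)// ?nnegrE ?sqrtr_ge0 ?enorm_ge0//.
rewrite (sqr_sqrtr B0) sqr_enorm; apply: ler_sum => i _.
rewrite mxE; under eq_bigr do rewrite mxE.
apply: (le_trans (sqr_sum_mul_le _ _)).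
by rewrite -sqr_enorm xi1 expr1n mul1r.
Qed.

(** |S w|^2 = <w, A w> <= |A| |w|^2 if S is symmetric with S S = A. If A has no
    square root, then sqrtmx A = 0, and the right-hand side is nonnegative by
    [enorm_mulmxv_le]. *)
Lemma sqr_enorm_sqrtmx_le A w :
  enorm (mulmxv (sqrtmx A) w) ^+ 2 <= opnorm A * enorm w ^+ 2.
Proof.
rewrite /sqrtmx; case: xgetP => [S _ [[SS Spos] SA]|_].
  have -> : enorm (mulmxv S w) ^+ 2 = \sum_i w 0 i * mulmxv A w 0 i.
    have dotE (a b : 'rV[R]_n) : \sum_i a 0 i * b 0 i = (a *m b^T) 0 0.
      by rewrite mxE; apply: eq_bigr => i _; rewrite [b^T _ _]mxE.
    rewrite sqr_enorm; under eq_bigr do rewrite expr2.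
    rewrite !dotE -SA /mulmxv !trmx_mul !trmxK SS.
    by rewrite !mulmxA.
  apply: (le_trans (sum_mul_le_enorm _ _)).
  by rewrite expr2 mulrA mulrC ler_wpM2r ?enorm_ge0 ?enorm_mulmxv_le.
rewrite /mulmxv trmx0 mulmx0 sqr_enorm big1 => [|i _]; last first.
  by rewrite mxE expr0n.
have := enorm_mulmxv_le A w; have := enorm_ge0 w.
rewrite le_eqVlt => /predU1P[<- _|w0 h]; first by rewrite expr0n mulr0.
rewrite mulr_ge0 ?sqr_ge0// -(pmulr_lge0 _ w0).
by rewrite (le_trans _ h)// enorm_ge0.
Qed.

(** The form in which the hypothesis on v enters: at a point where A = Q x, the
    right-hand side is at most c2 v |w|^p. *)
Lemma enorm_sqrtmx_powR_le A w p : 0 < p ->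
  enorm (mulmxv (sqrtmx A) w) `^ p <= opnorm A `^ (p / 2) * enorm w `^ p.
Proof.
move=> p0.
have pow2 (x : R) : 0 <= x -> x `^ p = (x ^+ 2) `^ (p / 2).
  by move=> x0; rewrite -powR_mulrn// -powRrM mulrCA divff// mulr1.
have sq := sqr_enorm_sqrtmx_le A w.
have [Q0|Q0] := leP 0 (opnorm A).
  rewrite pow2 ?enorm_ge0// (pow2 (enorm w)) ?enorm_ge0// -powRM ?sqr_ge0//.
  rewrite ge0_ler_powR ?nnegrE ?mulr_ge0 ?exprn_ge0 ?enorm_ge0//.
  exact: ltW.
have : enorm (mulmxv (sqrtmx A) w) ^+ 2 <= 0.
  by rewrite (le_trans sq)// mulr_le0_ge0 ?sqr_ge0// ltW.
rewrite le_eqVlt ltNge sqr_ge0 orbF sqrf_eq0 => /eqP ->.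
by rewrite powR0 ?gt_eqF// mulr_ge0 ?powR_ge0.
Qed.

Lemma enorm_le (c : R) w : 0 <= c -> (forall i, `|w 0 i| <= c) ->
  enorm w <= Num.sqrt (n%:R * c ^+ 2).
Proof.
move=> c0 wc; rewrite ler_wsqrtr//.
have -> : n%:R * c ^+ 2 = \sum_(i < n) c ^+ 2.
  by rewrite sumr_const card_ord mulr_natl.
by apply: ler_sum => i _; rewrite -[leLHS]real_normK ?num_real// lerXn2r ?nnegrE.
Qed.

End euclidean_norm.

(** * Lipschitz functions and their derivatives *)

Section lipschitz_near.
Context {R : realType} {V : normedModType R}.
Implicit Types (f g : V -> R) (x y z : V).

(** The Lipschitz condition at a point with an explicit constant and an explicit
    neighbourhood, which is easier to combine under algebraic operations. *)
Definition lipschitz_near f x := exists2 k : R, 0 <= k &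
  exists2 U, nbhs x U & forall y z, U y -> U z -> `|f y - f z| <= k * `|y - z|.

Lemma lipschitz_nearP f x :
  lipschitz_near f x <-> exists2 U, nbhs x U & [lipschitz f y | y in U].
Proof.
split=> [[k k0 [U xU Uk]]|[U xU]].
  exists U => //; exists k; split; first exact: num_real.
  move=> M kM [y z] [/= Uy Uz]; apply: (le_trans (Uk _ _ Uy Uz)).
  by rewrite ler_wpM2r// ltW.
move=> [M0 [_ HM]]; exists (Num.max 0 M0 + 1).
  by rewrite addr_ge0// le_max lexx.
exists U => // y z Uy Uz; apply: (HM _ _ (y, z)); last by split.
by rewrite ltr_pwDr// le_max lexx orbT.
Qed.

Lemma lipschitz_near_cst (c : R) x : lipschitz_near (fun=> c) x.
Proof.
exists 0 => //; exists setT; first exact: filterT.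
by move=> y z _ _; rewrite subrr normr0 mul0r.
Qed.

Lemma near_eq_lipschitz_near f g x : {near x, f =1 g} ->
  lipschitz_near f x -> lipschitz_near g x.
Proof.
move=> fg [k k0 [U xU Uk]]; exists k => //.
exists (U `&` [set y | f y = g y]); first exact: filterI.
by move=> y z [Uy <-] [Uz <-]; exact: Uk.
Qed.

Lemma lipschitz_near_continuous f x : lipschitz_near f x ->
  {for x, continuous f}.
Proof.
move=> [k k0 [U xU Uk]]; apply/cvgrPdist_le => e e0.
have k1 : 0 < k + 1 by rewrite ltr_wpDl.
have Bx : nbhs x [set y | `|x - y| <= e / (k + 1)].
  have : nbhs x (ball x (e / (k + 1))) by apply: nbhsx_ballx; rewrite divr_gt0.
  by apply: filterS => y; rewrite -ball_normE => /ltW.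
near=> y; have Uy : U y by near: y.
apply: (le_trans (Uk _ _ (nbhs_singleton xU) Uy)).
have xy : `|x - y| <= e / (k + 1) by near: y.
apply: (@le_trans _ _ (k * (e / (k + 1)))); first by rewrite ler_wpM2l.
rewrite mulrCA ler_piMr ?ler_pdivrMr ?mul1r ?lerDl//; exact: ltW.
Unshelve. all: by end_near. Qed.

Lemma lipschitz_nearD f g x : lipschitz_near f x -> lipschitz_near g x ->
  lipschitz_near (f \+ g) x.
Proof.
move=> [k k0 [U xU Uk]] [l l0 [W xW Wl]]; exists (k + l); first exact: addr_ge0.
exists (U `&` W) => [|y z [Uy Wy] [Uz Wz]]; first exact: filterI.
rewrite /= opprD addrACA mulrDl; apply: (le_trans (ler_normD _ _)).
by rewrite lerD ?Uk ?Wl.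
Qed.

Lemma lipschitz_near_bounded f x : lipschitz_near f x ->
  exists2 b : R, 0 <= b & nbhs x [set y | `|f y| <= b].
Proof.
move=> /lipschitz_near_continuous /cvgrPdist_le /(_ 1 ltr01) h.
exists (`|f x| + 1); first exact: addr_ge0.
apply: filterS h => y /= h; rewrite -[f y](subrK (f x)) addrC.
by apply: (le_trans (ler_normD _ _)); rewrite lerD2l distrC.
Qed.

Lemma lipschitz_nearM f g x : lipschitz_near f x -> lipschitz_near g x ->
  lipschitz_near (f \* g) x.
Proof.
move=> Lf Lg; have [a a0 xa] := lipschitz_near_bounded Lf.
have [b b0 xb] := lipschitz_near_bounded Lg.
move: Lf Lg => [k k0 [U xU Uk]] [l l0 [W xW Wl]].
exists (a * l + b * k); first by rewrite addr_ge0 ?mulr_ge0.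
exists ((U `&` W) `&` ([set y | `|f y| <= a] `&` [set y | `|g y| <= b])).
  by apply: filterI; exact: filterI.
move=> y z [[Uy Wy] [/= fa _]] [[Uz Wz] [/= _ gb]].
have -> : f y * g y - f z * g z = f y * (g y - g z) + g z * (f y - f z) by ring.
apply: (le_trans (ler_normD _ _)); rewrite mulrDl !normrM -!mulrA.
by rewrite lerD// ler_pM ?normr_ge0// ?Uk ?Wl.
Qed.

Lemma lipschitz_near_sum (I : Type) (s : seq I) (F : I -> V -> R) x :
  (forall i, lipschitz_near (F i) x) ->
  lipschitz_near (fun y => \sum_(i <- s) F i y) x.
Proof.
move=> LF; elim: s => [|i s IH].
  by under [X in lipschitz_near X]eq_fun do rewrite big_nil; exact: lipschitz_near_cst.
under [X in lipschitz_near X]eq_fun do rewrite big_cons.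
exact: lipschitz_nearD.
Qed.

Lemma lipschitz_near_max0 f x : lipschitz_near f x ->
  lipschitz_near (fun y => Num.max 0 (f y)) x.
Proof.
move=> [k k0 [U xU Uk]]; exists k => //; exists U => // y z Uy Uz.
apply: le_trans (Uk _ _ Uy Uz).
have maxE (a : R) : Num.max 0 a = (a + `|a|) / 2.
  by have [a0|a0] := leP 0 a; [rewrite ger0_norm|rewrite ltr0_norm]; lra.
rewrite !maxE; have := ler_dist_dist (f y) (f z); have := ler_norm (f y - f z).
have := ler_normB (f y) (f z).
set d := `|f y - f z|; rewrite -mulrBl normrM (@gtr0_norm _ 2^-1)//.
move=> _ _ h; rewrite ler_pdivrMr//.
have -> : f y + `|f y| - (f z + `|f z|) = (f y - f z) + (`|f y| - `|f z|) by ring.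
apply: (le_trans (ler_normD _ _)); rewrite -/d; lra.
Qed.

End lipschitz_near.

Lemma locally_lipschitzP {R : realType} {n : nat} A (f : 'rV[R]_n -> R) :
  locally_lipschitz A f <-> forall x, A x -> lipschitz_near f x.
Proof. by split=> h x Ax; apply/lipschitz_nearP; exact: h. Qed.

Section derivatives.
Context {R : realType} {V : normedModType R}.
Implicit Types (f g : V -> R) (x v : V).

Lemma derive_default f x v : ~ derivable f x v -> 'D_v f x = 0.
Proof. exact: dvgP. Qed.

(** A remainder of second order in h makes the difference quotients converge at
    linear speed. *)
Lemma is_derive_of_remainder f x v (l c : R) :
  (forall h, `|h| <= 1 -> `|f (h *: v + x) - f x - h * l| <= c * h ^+ 2) ->
  is_derive x v f l.
Proof.
move=> H.
have cv : (fun h : R => h^-1 *: ((f \o shift x) (h *: v) - f x)) @ 0^' --> l.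
  apply/cvgrPdist_le => e e0; near=> h.
  have hN : h != 0 by near: h; exact: nbhs_dnbhs_neq.
  have : `|h| <= Num.min 1 (e / (`|c| + 1)).
    near: h; apply: nbhs_dnbhs.
    have := @nbhs0_le _ R^o (Num.min 1 (e / (`|c| + 1))); apply.
    by rewrite lt_min ltr01 divr_gt0// ltr_wpDl.
  rewrite le_min => /andP[h1 hc].
  have hp : 0 < `|h| by rewrite normr_gt0.
  rewrite distrC -(ler_pM2l hp) -normrM mulrBr.
  have -> : h * (h^-1 *: ((f \o shift x) (h *: v) - f x)) = f (h *: v + x) - f x.
    by rewrite /= /GRing.scale /= mulrA mulfV// mul1r.
  apply: (le_trans (H _ h1)); rewrite -real_normK ?num_real// expr2 mulrCA.
  rewrite ler_wpM2l// mulrC.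
  apply: (@le_trans _ _ (`|h| * (`|c| + 1))).
    by rewrite ler_wpM2l// (le_trans (ler_norm c))// lerDl.
  by rewrite -ler_pdivlMr// ltr_wpDl.
by apply: DeriveDef; [apply/cvg_ex; exists l|exact: cvg_lim].
Unshelve. all: by end_near. Qed.

(** The product rule, valid even where f has no derivative along v and 'D_v f x
    is 0 by default. If g x != 0, then f = g^-1 * (g * f) near x, so g * f is not
    derivable either and both sides are 0, with w = 0. If g x = 0, then the
    difference quotient of g * f is that of g times a value of f near x, so g * f
    has the derivative f x * 'D_v g x. *)
Lemma derive_mul_bounded f g x v :
  {for x, continuous f} -> {for x, continuous g} -> derivable g x v ->
  exists2 w : R, `|w| <= `|'D_v g x| &
    'D_v (g \* f) x = g x * 'D_v f x + f x * w.
Proof.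
move=> cf cg dg; have [df|ndf] := pselect (derivable f x v).
  exists ('D_v g x); first exact: lexx.
  by rewrite [LHS](deriveM dg df).
suff [w wg gfw] : exists2 w : R, `|w| <= `|'D_v g x| & 'D_v (g \* f) x = f x * w.
  exists w; first exact: wg.
  by rewrite (derive_default ndf) mulr0 add0r.
have [g0|gN] := eqVneq (g x) 0; last first.
  exists 0; first by rewrite normr0.
  rewrite mulr0; apply: derive_default => dgf; apply: ndf.
  have dg' := @derivableV _ _ g x v gN dg.
  have := @derivableM _ _ _ _ _ _ dg' dgf.
  apply: near_eq_derivable; near=> y.
  have : g y != 0.
    by near: y; move/cvgr_neq0: cg; exact.
  by move=> gy; rewrite /GRing.mul /= mulKf.
exists ('D_v g x); first exact: lexx.
rewrite mulrC; apply: cvg_lim; first exact: norm_hausdorff.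
have -> : (fun h : R => h^-1 *: (((g \* f) \o shift x) (h *: v) - (g \* f) x)) =
   (fun h => (h^-1 *: ((g \o shift x) (h *: v) - g x)) * f (h *: v + x)).
  apply/funext => h /=; rewrite g0 mul0r !subr0.
  by rewrite -scalerAl.
apply: cvgM; first exact: dg.
have hx : h *: v + x @[h --> (0:R)^'] --> x.
  rewrite -[X in _ --> X]add0r -[X in _ --> X + _](scale0r v).
  apply: cvgD; last exact: cvg_cst.
  apply: cvgZr_tmp; exact: nbhs_dnbhs.
exact: (cvg_comp _ _ hx cf).
Unshelve. all: by end_near. Qed.

End derivatives.

Section cutoff.
Context {R : realType} {n : nat}.
Implicit Types (a x y : 'rV[R]_n) (t e : R).

(** The squared Euclidean distance: unlike the distance, it is a polynomial. *)
Definition sqdist a y : R := \sum_i (y 0 i - a 0 i) ^+ 2.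

(** Squaring the positive part makes this bump of class C^1. It is supported in the
    Euclidean ball of radius sqrt t and bounded below on the ball of
    radius sqrt (t / 2). *)
Definition cutoff a t y : R := Num.max 0 (t - sqdist a y) ^+ 2.

Lemma coord_le_norm y (i : 'I_n) : `|y 0 i| <= `|y|.
Proof.
rewrite [leRHS]mx_normrE; exact: (le_bigmax _ _ (0, i)).
Qed.

Lemma norm_le_coord y e : 0 <= e -> (forall i, `|y 0 i| <= e) -> `|y| <= e.
Proof.
by move=> e0 ye; rewrite [leLHS]mx_normrE; apply: bigmax_le => // -[j i] _ /=; rewrite ord1.
Qed.

Lemma lipschitz_near_sqdist a x : lipschitz_near (sqdist a) x.
Proof.
apply: (@lipschitz_near_sum _ _ 'I_n _ (fun i y => (y 0 i - a 0 i) ^+ 2)) => i.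
have Lc : lipschitz_near (fun y : 'rV[R]_n => y 0 i - a 0 i) x.
  exists 1 => //; exists setT; first exact: filterT.
  move=> y z _ _; rewrite mul1r opprB addrA subrK.
  by have := coord_le_norm (y - z) i; rewrite !mxE.
exact: (lipschitz_nearM Lc Lc).
Qed.

Lemma lipschitz_near_cutoff a t x : lipschitz_near (cutoff a t) x.
Proof.
have Lm : lipschitz_near (fun y => Num.max 0 (t - sqdist a y)) x.
  apply: lipschitz_near_max0; apply: lipschitz_nearD.
    exact: lipschitz_near_cst.
  rewrite (_ : (fun y => - sqdist a y) = (fun=> -1) \* sqdist a).
    exact: lipschitz_nearM (lipschitz_near_cst _ _) (lipschitz_near_sqdist _ _).
  by apply/funext => y /=; rewrite mulN1r.
exact: (lipschitz_nearM Lm Lm).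
Qed.

Lemma sqdist_ge0 a y : 0 <= sqdist a y.
Proof. exact: sum_sqr_ge0. Qed.

Lemma sqdistxx a : sqdist a a = 0.
Proof. by rewrite /sqdist big1// => i _; rewrite subrr expr0n. Qed.

Lemma cutoff_ge0 a t y : 0 <= cutoff a t y.
Proof. exact: sqr_ge0. Qed.

Lemma cutoff_le a t y : 0 <= t -> cutoff a t y <= t ^+ 2.
Proof.
move=> t0; rewrite ler_pXn2r ?nnegrE ?le_max ?lexx//.
by rewrite ge_max t0 gerBl sqdist_ge0.
Qed.

Lemma cutoff_ge a t y : 0 <= t -> sqdist a y <= t / 2 ->
  (t / 2) ^+ 2 <= cutoff a t y.
Proof.
move=> t0 yt; rewrite ler_pXn2r ?nnegrE ?le_max ?lexx ?divr_ge0//.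
by apply/orP; right; lra.
Qed.

Lemma cutoff_neq0 a t y : cutoff a t y != 0 -> sqdist a y < t.
Proof.
move=> y0; rewrite ltNge; apply: contraNN y0 => ty.
by rewrite /cutoff max_l ?expr0n// subr_le0.
Qed.

Lemma sqdist_norm_le a y e : 0 <= e -> sqdist a y <= e ^+ 2 -> `|y - a| <= e.
Proof.
move=> e0 ye; apply: norm_le_coord => // i; rewrite !mxE.
rewrite -(@ler_pXn2r _ 2) ?nnegrE// real_normK ?num_real//.
apply: le_trans ye; rewrite /sqdist (bigD1 i)//= lerDl.
by apply: sumr_ge0 => j _; exact: sqr_ge0.
Qed.

Lemma continuous_sqdist a : continuous (sqdist a).
Proof.
by move=> x; apply: lipschitz_near_continuous; exact: lipschitz_near_sqdist.
Qed.

(** The function s |-> max(0, s)^2 has derivative 2 max(0, s), with a second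
    order remainder that is uniform in s; this includes the kink at 0. *)
Let pos_sqr_remainder (s d : R) :
  `|Num.max 0 (s + d) ^+ 2 - Num.max 0 s ^+ 2 - 2 * Num.max 0 s * d| <= d ^+ 2.
Proof.
have [s0|s0] := leP 0 s; have [sd0|sd0] := leP 0 (s + d).
- by rewrite ler_norml; apply/andP; split; nra.
- by rewrite ler_norml; apply/andP; split; nra.
- by rewrite ler_norml; apply/andP; split; nra.
- by rewrite !expr0n /= mulr0 mul0r !subr0 normr0 sqr_ge0.
Qed.

Let sqdist_shift a x h (i : 'I_n) :
  sqdist a (h *: delta_mx 0 i + x) =
    sqdist a x + (2 * h * (x 0 i - a 0 i) + h ^+ 2).
Proof.
rewrite /sqdist (bigD1 i)//= [in RHS](bigD1 i)//= !mxE !eqxx /= mulr1.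
rewrite [X in _ + X = _](_ : _ = \sum_(j | j != i) (x 0 j - a 0 j) ^+ 2).
  by ring.
by apply: eq_bigr => j ji; rewrite !mxE (negbTE ji) andbF mulr0 add0r.
Qed.

Lemma is_derive_cutoff a t x (i : 'I_n) :
  is_derive x (delta_mx 0 i) (cutoff a t)
    (- 4 * Num.max 0 (t - sqdist a x) * (x 0 i - a 0 i)).
Proof.
set s := t - sqdist a x; set m := Num.max 0 s; set b := x 0 i - a 0 i.
have m0 : 0 <= m by rewrite le_max lexx.
apply: (@is_derive_of_remainder _ _ _ _ _ _ (2 * m + (2 * `|b| + 1) ^+ 2)) => h h1.
pose d := - (2 * h * b + h ^+ 2).
have -> : cutoff a t (h *: delta_mx 0 i + x) = Num.max 0 (s + d) ^+ 2.
  by rewrite /cutoff sqdist_shift opprD addrA.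
rewrite /cutoff -/s -/m.
have -> : Num.max 0 (s + d) ^+ 2 - m ^+ 2 - h * (- 4 * m * b) =
  (Num.max 0 (s + d) ^+ 2 - m ^+ 2 - 2 * m * d) + (- (2 * m * h ^+ 2)).
  by rewrite /d; ring.
apply: (le_trans (ler_normD _ _)); rewrite [leRHS]mulrDl [leRHS]addrC.
apply: lerD; last first.
  by rewrite normrN ger0_norm// mulr_ge0 ?sqr_ge0 ?mulr_ge0.
apply: (le_trans (pos_sqr_remainder _ _)).
have -> : d ^+ 2 = (2 * b + h) ^+ 2 * h ^+ 2 by rewrite /d; ring.
rewrite ler_wpM2r ?sqr_ge0// -[leLHS]real_normK ?num_real//.
rewrite ler_pXn2r ?nnegrE ?addr_ge0 ?mulr_ge0//.
by rewrite (le_trans (ler_normD _ _))// normrM (@gtr0_norm _ 2)// lerD2l.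
Qed.

(** Where the derivative is not 0, |x i - a i|^2 <= sqdist a x <= t, and
    sqrt t <= 1 + t. *)
Lemma derive_cutoff_le a t x (i : 'I_n) : 0 <= t ->
  `|'D_(delta_mx 0 i) (cutoff a t) x| <= 4 * t * (1 + t).
Proof.
move=> t0; rewrite (derive_val (is_derive := is_derive_cutoff a t x i)).
have [xt|xt] := leP (t - sqdist a x) 0.
  by rewrite mulr0 mul0r normr0 !mulr_ge0 ?addr_ge0.
rewrite !normrM (gtr0_norm xt) (@normrN _ _ 4) (@gtr0_norm _ 4)// -!mulrA.
rewrite ler_wpM2l// ler_pM ?normr_ge0 ?(ltW xt)//.
  by rewrite gerBl sqdist_ge0.
have h : (x 0 i - a 0 i) ^+ 2 <= t.
  rewrite (@le_trans _ _ (sqdist a x))//; last by rewrite -subr_ge0 ltW.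
  rewrite /sqdist (bigD1 i)//= lerDl.
  by apply: sumr_ge0 => j _; exact: sqr_ge0.
move: h; rewrite -[X in X <= t]real_normK ?num_real//.
set z := `|_|; have : 0 <= z by exact: normr_ge0.
by nra.
Qed.

End cutoff.

Section lip0.
Context {R : realType} {n : nat}.
Implicit Types (f : 'rV[R]_n -> R) (E B : set 'rV[R]_n) (x : 'rV[R]_n).

(** Lip0 asks for the Lipschitz condition on E only; since the support is a closed
    subset of E, f is 0 near every other point. Hence f is locally Lipschitz on
    the whole space, and continuous. *)
Lemma Lip0_vanishes E f x : Lip0 E f -> ~ E x -> \near x, f x = 0.
Proof.
move=> [_ [_ suppE]] nEx.
have : open_nbhs x (~` closure [set x | f x != 0]).
  split; first by apply: closed_openC; exact: closed_closure.
  by move=> /suppE.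
move=> /open_nbhs_nbhs; apply: filterS => y ny.
by apply: contrapT => /eqP fy; apply: ny; exact: subset_closure.
Qed.

Lemma Lip0_eq0 E f x : Lip0 E f -> ~ E x -> f x = 0.
Proof. by move=> fE nEx; exact: nbhs_singleton (Lip0_vanishes fE nEx). Qed.

Lemma Lip0_lipschitz_near E f x : Lip0 E f -> lipschitz_near f x.
Proof.
move=> fE; have [Ex|nEx] := pselect (E x).
  by move: fE => [/locally_lipschitzP h _]; exact: h.
apply: near_eq_lipschitz_near (lipschitz_near_cst 0 x).
by apply: filterS (Lip0_vanishes fE nEx) => y.
Qed.

Lemma Lip0_continuous E f : Lip0 E f -> continuous f.
Proof.
move=> fE x; apply: lipschitz_near_continuous; exact: Lip0_lipschitz_near fE.
Qed.

Lemma Lip0_grad_eq0 E f x : Lip0 E f -> ~ E x -> grad f x = 0.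
Proof.
move=> fE nEx; apply/rowP => i; rewrite !mxE.
rewrite (@near_eq_derive _ _ _ f (cst 0)); last exact: Lip0_vanishes fE nEx.
exact: derive_cst.
Qed.

Lemma Lip0_locally_lipschitz E A f : Lip0 E f -> locally_lipschitz A f.
Proof.
by move=> fE; apply/locally_lipschitzP => x _; exact: Lip0_lipschitz_near fE.
Qed.

Lemma Lip0_cutoff E B f a t : Lip0 E f -> [set y | sqdist a y <= t] `<=` B ->
  Lip0 B (cutoff a t \* f).
Proof.
move=> fE tB; split.
  apply/locally_lipschitzP => x _.
  by apply: lipschitz_nearM (lipschitz_near_cutoff a t x) (Lip0_lipschitz_near _ fE).
have sub : closure [set x | (cutoff a t \* f) x != 0] `<=`
           closure [set x | f x != 0].
  by apply: closure_subset => x /=; apply: contra_neq => ->; rewrite mulr0.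
split.
  by apply: subclosed_compact sub; [exact: closed_closure|case: fE => _ []].
apply: subset_trans tB; rewrite [X in _ `<=` X](iffLR (closure_id _)).
  apply: closure_subset => x /= h; apply: ltW; apply: cutoff_neq0.
  by apply: contra_neq h => ->; rewrite mul0r.
apply: (@preimage_closed _ _ (sqdist a) [set y | y <= t]); last exact: closed_le.
by move=> x _; exact: continuous_sqdist.
Qed.

(** The product rule for the gradient at every point x, including the points where
    grad f x is a default value. The vector w need not be the gradient of the
    cut-off function, but satisfies the same bound. *)
Lemma grad_cutoff a t f x : 0 <= t -> {for x, continuous f} ->
  exists2 w : 'rV[R]_n, (forall i, `|w 0 i| <= 4 * t * (1 + t)) &
    grad (cutoff a t \* f) x = cutoff a t x *: grad f x + f x *: w.
Proof.
move=> t0 cf.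
have H i : exists w : R, `|w| <= 4 * t * (1 + t) /\
    'D_(delta_mx 0 i) (cutoff a t \* f) x =
      cutoff a t x * 'D_(delta_mx 0 i) f x + f x * w.
  have cc : {for x, continuous (cutoff a t)}.
    by apply: lipschitz_near_continuous; exact: lipschitz_near_cutoff.
  have dc : derivable (cutoff a t) x (delta_mx 0 i).
    exact: (@ex_derive _ _ _ _ _ _ _ (is_derive_cutoff a t x i)).
  have [w wle wE] := derive_mul_bounded cf cc dc.
  by exists w; split; [exact: le_trans wle (derive_cutoff_le _ _ _ t0)|exact: wE].
have /choice[w Hw] := H; exists (\row_i w i) => [i|].
  by rewrite mxE; have [] := Hw i.
apply/rowP => i; rewrite mxE [RHS]mxE [X in X + _]mxE [X in _ + X]mxE !mxE.
by have [_ ->] := Hw i.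
Qed.

End lip0.

(** * Energies of functions of Lip_0(E) *)

Section borel.
Context {R : realType} {n : nat} {M : set (set 'rV[R]_n)}.
Hypothesis hM_borel : open `<=` M.

Lemma open_mu_measurable (U : set 'rV[R]_n) : open U ->
  measurable (U : set (g_sigma_algebraType M)).
Proof. by move=> oU; apply: sub_sigma_algebra; exact: hM_borel. Qed.

Lemma continuous_mu_measurable (D : set 'rV[R]_n) (f : 'rV[R]_n -> R) :
  measurable (D : set (g_sigma_algebraType M)) -> continuous f ->
  mu_measurable (M := M) D f.
Proof.
move=> mD cf; apply: (measurability _ (RGenOInfty.measurableE R)).
move=> _ [_ [x ->] <-]; apply: measurableI => //.
apply: open_mu_measurable; apply: open_comp => [y _|]; first exact: cf.
exact: interval_open.
Qed.

End borel.

Section sobolev.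
Context {R : realType} {n : nat} {M : set (set 'rV[R]_n)}.
Hypothesis hM_borel : open `<=` M.
Variable mu : {measure set (g_sigma_algebraType M) -> \bar R}.
Variables (Q : 'rV[R]_n -> 'M[R]_n) (v : 'rV[R]_n -> R) (p c2 : R).
Variables (Omega E : set 'rV[R]_n).
Hypothesis p0 : 0 < p.
Hypothesis v0 : forall x, Omega x -> 0 <= v x.
Hypothesis mv : mu_measurable (M := M) Omega v.
Hypothesis hc2 : 0 < c2.
Hypothesis hv0 : forall x, Omega x -> opnorm (Q x) `^ (p / 2) <= c2 * v x.
Hypothesis oOmega : open Omega.
Hypothesis oE : open E.
Hypothesis EOmega : E `<=` Omega.

(** The p-th power of LQ_norm. It is used also for the gradients of Lip_0
    functions, without reference to their measurability. *)
Definition LQ_pow (A : set 'rV[R]_n) (k : 'rV[R]_n -> 'rV[R]_n) : \bar R :=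
  (\int[mu]_(x in (A : set (g_sigma_algebraType M)))
     (enorm (mulmxv (sqrtmx (Q x)) (k x)) `^ p)%:E)%E.

Lemma LQ_pow_ge0 A k : (0 <= LQ_pow A k)%E.
Proof. by apply: integral_ge0 => x _; rewrite lee_fin powR_ge0. Qed.

Let mOmega : measurable (Omega : set (g_sigma_algebraType M)).
Proof. exact: open_mu_measurable. Qed.

Let mE : measurable (E : set (g_sigma_algebraType M)).
Proof. exact: open_mu_measurable. Qed.

Let weighted_ge0 (r : R) (f : 'rV[R]_n -> R) x : Omega x ->
  (0 <= (`|f x| `^ r * v x)%:E)%E.
Proof. by move=> Ox; rewrite lee_fin mulr_ge0 ?powR_ge0 ?v0. Qed.

Lemma QH_norm_le A f k (a b : R) : A `<=` Omega -> 0 <= a -> 0 <= b ->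
  (Lv_pow mu A v p f <= a%:E)%E -> (LQ_pow A k <= b%:E)%E ->
  (QH_norm mu Q v p A f k <= (a `^ p^-1 + b `^ p^-1)%:E)%E.
Proof.
move=> AO a0 b0 fa kb; rewrite EFinD; apply: leeD.
- apply/poweR_inv_le => //; [|exact: powR_ge0|].
    by apply: Lv_pow_ge0 => x /AO; exact: v0.
  by rewrite -powRrM mulVf ?powRr1// gt_eqF.
- apply/poweR_inv_le => //; [exact: LQ_pow_ge0|exact: powR_ge0|].
  by rewrite -powRrM mulVf ?powRr1// gt_eqF.
Qed.

Lemma QH_norm_ge A f k (c : R) : A `<=` Omega ->
  (QH_norm mu Q v p A f k <= c%:E)%E ->
  (Lv_pow mu A v p f <= (c `^ p)%:E)%E /\ (LQ_pow A k <= (c `^ p)%:E)%E.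
Proof.
move=> AO fc.
have l0 : (0 <= Lv_norm mu v p A f)%E by exact: poweR_ge0.
have q0 : (0 <= LQ_norm mu Q p A k)%E by exact: poweR_ge0.
have c0 : 0 <= c by rewrite -lee_fin (le_trans _ fc)// adde_ge0.
split.
- apply/poweR_inv_le => //.
    by apply: Lv_pow_ge0 => x /AO; exact: v0.
  by apply: le_trans fc; rewrite leeDl.
- apply/poweR_inv_le => //; first exact: LQ_pow_ge0.
  by apply: le_trans fc; rewrite leeDr.
Qed.

Lemma Lv_pow_Lip0 (r : R) f A : 0 < r -> Lip0 E f -> E `<=` A ->
  Lv_pow mu A v r f = Lv_pow mu E v r f.
Proof.
move=> r0 fE EA; apply: integral_eq_support => // x _ nEx.
by rewrite (Lip0_eq0 fE nEx) normr0 powR0 ?gt_eqF// mul0r.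
Qed.

Lemma LQ_pow_Lip0 f A : Lip0 E f -> E `<=` A ->
  LQ_pow A (grad f) = LQ_pow E (grad f).
Proof.
move=> fE EA; apply: integral_eq_support => // x _ nEx.
rewrite (Lip0_grad_eq0 fE nEx) /mulmxv mul0mx /enorm big1 => [|i _].
  by rewrite sqrtr0 powR0 ?gt_eqF.
by rewrite mxE expr0n.
Qed.

(** By [grad_cutoff] the gradient of the product has the two terms
    cutoff * grad f and f * w with w bounded. The first is part of the energy of f.
    The second is controlled by |f|^p * v, because |sqrt Q w|^p <= c2 * v * |w|^p; its
    measurability is what allows the integral of the sum to be split. *)
Lemma cutoff_energy_le (a : 'rV[R]_n) t f (b : R) : 0 <= t -> 0 <= b ->
  Lip0 E f ->
  (Lv_pow mu E v p f <= b%:E)%E -> (LQ_pow E (grad f) <= b%:E)%E ->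
  (Lv_pow mu Omega v p (cutoff a t \* f)%R <= ((t ^+ 2) `^ p * b)%:E)%E /\
  (LQ_pow Omega (grad (cutoff a t \* f)%R) <=
    (2 `^ p * ((t ^+ 2) `^ p
        + c2 * Num.sqrt (n%:R * (4 * t * (1 + t)) ^+ 2) `^ p) * b)%:E)%E.
Proof.
move=> t0 b0 fE fb gb.
have fbO : (Lv_pow mu Omega v p f <= b%:E)%E by rewrite (Lv_pow_Lip0 p0 fE).
have gbO : (LQ_pow Omega (grad f) <= b%:E)%E by rewrite (LQ_pow_Lip0 fE).
have cf := Lip0_continuous fE.
have T0 : 0 <= (t ^+ 2) `^ p by exact: powR_ge0.
set l := 4 * t * (1 + t); set L := Num.sqrt _.
have l0 : 0 <= l by rewrite !mulr_ge0 ?addr_ge0.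
have mf : mu_measurable (M := M) Omega f by exact: continuous_mu_measurable.
split.
  apply: (@le_trans _ _ (((t ^+ 2) `^ p)%:E * Lv_pow mu Omega v p f)%E).
    apply: le_trans (integral_innerZ_le _ T0 _); last first.
      by move=> x Ox; exact: weighted_ge0.
    apply: le_integral_inner => // x Ox.
    - exact: weighted_ge0.
    - by rewrite mule_ge0 ?lee_fin// mulr_ge0 ?powR_ge0 ?v0.
    rewrite -EFinM lee_fin mulrA ler_wpM2r ?v0// -powRM ?sqr_ge0//.
    rewrite ge0_ler_powR ?nnegrE ?mulr_ge0 ?sqr_ge0 ?(ltW p0)//= normrM.
    by rewrite ler_wpM2r// ger0_norm ?cutoff_ge0// cutoff_le.
  by rewrite EFinM lee_wpmul2l// lee_fin.
set g := fun x => enorm (mulmxv (sqrtmx (Q x)) (grad f x)) `^ p.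
have g0 x : 0 <= g x by exact: powR_ge0.
set h := fun x => `|f x| `^ p * v x.
have h0 x : Omega x -> 0 <= h x by move=> Ox; rewrite mulr_ge0 ?powR_ge0 ?v0.
have key x : Omega x ->
    enorm (mulmxv (sqrtmx (Q x)) (grad (cutoff a t \* f) x)) `^ p <=
      2 `^ p * ((t ^+ 2) `^ p * g x + c2 * L `^ p * h x).
  move=> Ox; have [w wl ->] := grad_cutoff a t0 (cf x).
  rewrite mulmxvD !mulmxvZ.
  apply: (@le_trans _ _ ((enorm (cutoff a t x *: mulmxv (sqrtmx (Q x)) (grad f x))
     + enorm (f x *: mulmxv (sqrtmx (Q x)) w)) `^ p)).
    by rewrite ge0_ler_powR ?nnegrE ?addr_ge0 ?enorm_ge0 ?enormD_le ?(ltW p0).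
  apply: (le_trans (powR_add_le (ltW p0) (enorm_ge0 _) (enorm_ge0 _))).
  rewrite ler_wpM2l ?powR_ge0// !enormZ.
  rewrite (powRM _ (normr_ge0 (cutoff a t x)) (enorm_ge0 _)).
  rewrite (powRM _ (normr_ge0 (f x)) (enorm_ge0 _)).
  rewrite lerD//.
    apply: ler_wpM2r; first exact: powR_ge0.
    rewrite ge0_ler_powR ?nnegrE ?sqr_ge0 ?(ltW p0)//.
    by rewrite ger0_norm ?cutoff_ge0// cutoff_le.
  rewrite /h mulrCA ler_wpM2l ?powR_ge0//.
  apply: (le_trans (enorm_sqrtmx_powR_le _ _ p0)).
  rewrite mulrAC ler_pM ?powR_ge0 ?hv0//.
  by rewrite ge0_ler_powR ?nnegrE ?enorm_ge0 ?sqrtr_ge0 ?enorm_le ?(ltW p0).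
have K0 : 0 <= c2 * L `^ p by rewrite mulr_ge0 ?powR_ge0 ?(ltW hc2).
pose I := (\int[mu]_(x in (Omega : set (g_sigma_algebraType M)))
   (((t ^+ 2) `^ p)%:E * (g x)%:E + (c2 * L `^ p)%:E * (h x)%:E))%E.
have I0 x : Omega x ->
    (0 <= ((t ^+ 2) `^ p)%:E * (g x)%:E + (c2 * L `^ p)%:E * (h x)%:E)%E.
  by move=> Ox; rewrite adde_ge0// mule_ge0 ?lee_fin ?h0.
apply: (@le_trans _ _ ((2 `^ p)%:E * I)%E).
  apply: le_trans (integral_innerZ_le _ _ _); last 2 first.
  - exact: powR_ge0.
  - exact: I0.
  apply: le_integral_inner => // x Ox.
  - by rewrite lee_fin powR_ge0.
  - by apply: mule_ge0 (I0 x Ox); rewrite lee_fin powR_ge0.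
rewrite -mulrA EFinM lee_wpmul2l ?lee_fin ?powR_ge0//.
have mh : measurable_fun (Omega : set (g_sigma_algebraType M)) (EFin \o h).
  exact: (measurable_Lv_pow mv p mf).
apply: (le_trans (integral_innerD_le _ mOmega _ _ _)).
- by apply: measurable_funeM; exact: mh.
- by move=> x Ox; rewrite mule_ge0 ?lee_fin.
- by move=> x Ox; rewrite mule_ge0 ?lee_fin ?h0.
rewrite mulrDl EFinD; apply: leeD.
  apply: (le_trans (integral_innerZ_le _ T0 _)).
    by move=> x _; rewrite lee_fin.
  by rewrite EFinM lee_wpmul2l// lee_fin.
apply: (le_trans (integral_innerZ_le _ K0 _)).
  by move=> x Ox; rewrite lee_fin h0.
by rewrite [leRHS]EFinM lee_wpmul2l// lee_fin.
Qed.

End sobolev.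

(** * The Sobolev inequality on E *)

Section global_sobolev.
Context {R : realType} {n : nat} {M : set (set 'rV[R]_n)}.
Hypothesis hM_borel : open `<=` M.
Variable mu : {measure set (g_sigma_algebraType M) -> \bar R}.
Variables (Q : 'rV[R]_n -> 'M[R]_n) (v : 'rV[R]_n -> R) (p c2 : R).
Variables (Omega E : set 'rV[R]_n) (rho : 'rV[R]_n -> 'rV[R]_n -> R).
Hypothesis p0 : 0 < p.
Hypothesis v0 : forall x, Omega x -> 0 <= v x.
Hypothesis mv : mu_measurable (M := M) Omega v.
Hypothesis hc2 : 0 < c2.
Hypothesis hv0 : forall x, Omega x -> opnorm (Q x) `^ (p / 2) <= c2 * v x.
Hypothesis oOmega : open Omega.
Hypothesis oE : open E.
Hypothesis hE_inside : compactly_inside E Omega.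
Hypothesis hrho : quasimetric Omega rho.
Hypothesis hrho_open : balls_open Omega rho.

Lemma qball_center x r : Omega x -> 0 < r -> qball Omega rho x r x.
Proof.
move=> Ox r0; split=> //; have [kappa [_ /(_ x x x Ox Ox Ox)[_ [_ h] _ _]]] := hrho.
by rewrite h.
Qed.

(** The local Sobolev inequality holds for functions supported in a small ball
    B(x, s), so it is applied to f times a cut-off function. Dividing by the
    lower bound of the latter near x gives an estimate of f on a neighbourhood U of
    x, uniform over the functions f of bounded energy. Compactness of the closure
    of E combines finitely many such estimates; the measurable set A' that
    contains A is there because integrals over nonmeasurable sets are not
    subadditive. *)
Lemma global_sobolev sigma (b : R) : 0 < sigma ->
  local_sobolev mu Omega Q v p sigma rho -> 0 <= b ->
  exists B : R, forall f, Lip0 E f ->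
    (Lv_pow mu E v p f <= b%:E)%E -> (LQ_pow mu Q p E (grad f) <= b%:E)%E ->
    (Lv_pow mu E v (p * sigma) f <= B%:E)%E.
Proof.
move=> s0 hS b0; set r := p * sigma.
have r0 : 0 < r by rewrite mulr_gt0.
have [cE EO] := hE_inside.
have EOmega : E `<=` Omega by apply: subset_trans EO; exact: subset_closure.
have mE : measurable (E : set (g_sigma_algebraType M)) by exact: open_mu_measurable.
have vE x : E x -> 0 <= v x by move=> /EOmega; exact: v0.
have mvE : measurable_fun (E : set (g_sigma_algebraType M)) v.
  by apply: measurable_funS mv => //; exact: open_mu_measurable.
pose test f := [/\ Lip0 E f, (Lv_pow mu E v p f <= b%:E)%E &
  (LQ_pow mu Q p E (grad f) <= b%:E)%E].
pose P (A : set 'rV[R]_n) := exists A' : set (g_sigma_algebraType M),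
  [/\ measurable A', A `<=` A' & exists B : R, forall f, test f ->
    (Lv_pow mu (E `&` A') v r f <= B%:E)%E].
suff [A' [mA' EA' [B HB]]] : P (closure E).
  exists B => f fE fb gb; have := HB f (And3 fE fb gb).
  by rewrite setIidl// => x Ex; apply: EA'; exact: subset_closure.
apply: compact_induction => //.
- exists set0; split=> //; exists 0 => f _.
  by rewrite setI0 /Lv_pow integral_set0.
- move=> A A2 [B [mB AB [b1 Hb1]]] [B2 [mB2 AB2 [b2 Hb2]]].
  exists (B `|` B2); split; [exact: measurableU|exact: setUSS|].
  exists (b1 + b2) => f fP; rewrite setIUr EFinD.
  apply: le_trans (leeD (Hb1 f fP) (Hb2 f fP)).
  apply: ge0_integral_setU_le; [exact: measurableI|exact: measurableI| |].
    apply: measurable_funS (measurable_Lv_pow mvE r _) => //.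
      by move=> x [|] [].
    by apply: continuous_mu_measurable => //; case: fP => + _ _; exact: Lip0_continuous.
  by move=> x [|] [Ex _]; rewrite lee_fin mulr_ge0 ?powR_ge0 ?vE.
- move=> A A2 AA2 [B [mB AB HB]]; exists B; split=> //.
  exact: subset_trans AB.
move=> x Kx; have Ox := EO _ Kx.
have [d2 d20 Hd2] := hS _ cE EO.
(* The radius s may be any number in ]0, d2[, and t is so small that the
   support of the cut-off function lies in B(x, s). *)
pose s := d2 / 2; have s_gt0 : 0 < s by rewrite divr_gt0.
have s_lt : s < d2 by rewrite ltr_pdivrMr// ltr_pMr// ltr1n.
have [C HC] := Hd2 x s Kx s_gt0 s_lt.
set B := qball Omega rho x s in HC.
have oB : open B by exact: hrho_open.
have Bx : nbhs x B by apply: open_nbhs_nbhs; split=> //; exact: qball_center.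
have /nbhs_ballP[e /= e0 eB] := Bx.
have e2 : 0 < e / 2 by rewrite divr_gt0.
pose t := (e / 2) ^+ 2; have t0 : 0 < t by rewrite exprn_gt0.
have tB : [set y | sqdist x y <= t] `<=` B.
  move=> y yt; apply: eB; rewrite -ball_normE /= distrC.
  apply: (le_lt_trans (sqdist_norm_le (ltW e2) yt)).
  by rewrite ltr_pdivrMr// ltr_pMr// ltr1n.
pose U := [set y | sqdist x y < t / 2].
have oU : open U.
  apply: (@open_comp _ _ (sqdist x) [set y | y < t / 2]); last exact: open_lt.
  by move=> y _; exact: continuous_sqdist.
have Ux : nbhs x U.
  by apply: open_nbhs_nbhs; split=> //; rewrite /U /= sqdistxx divr_gt0.
have UB : U `<=` B.
  move=> y Uy; apply: tB; apply: ltW; apply: (lt_trans Uy).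
  by rewrite ltr_pdivrMr// ltr_pMr// ltr1n.
exists U => //; exists U; split=> //; first exact: open_mu_measurable.
pose b1 := (t ^+ 2) `^ p * b.
pose b2 := 2 `^ p * ((t ^+ 2) `^ p
        + c2 * Num.sqrt (n%:R * (4 * t * (1 + t)) ^+ 2) `^ p) * b.
pose b3 := `|C| * (b1 `^ p^-1 + b2 `^ p^-1).
pose b4 := ((t / 2) ^+ 2) `^ (- r).
have b10 : 0 <= b1 by rewrite mulr_ge0 ?powR_ge0.
have b20 : 0 <= b2.
  by rewrite !mulr_ge0 ?addr_ge0 ?powR_ge0// mulr_ge0 ?powR_ge0// ltW.
have b30 : 0 <= b3 by rewrite mulr_ge0 ?addr_ge0 ?powR_ge0.
have b40 : 0 <= b4 by exact: powR_ge0.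
exists (b4 * b3 `^ r) => f [fE fb gb].
have [h1 h2] := cutoff_energy_le hM_borel p0 v0 mv hc2 hv0 oOmega EOmega
  x (ltW t0) b0 fE fb gb.
have nO := QH_norm_le p0 v0 (@subset_refl _ Omega) b10 b20 h1 h2.
have fB : Lip0 B (cutoff x t \* f) by exact: Lip0_cutoff fE tB.
have BO : B `<=` Omega by move=> y [].
have hB : (Lv_pow mu B v r (cutoff x t \* f)%R <= (b3 `^ r)%:E)%E.
  apply/poweR_inv_le => //.
    by apply: Lv_pow_ge0 => y /BO; exact: v0.
  apply: (le_trans (HC _ fB)).
  apply: (@le_trans _ _ (`|C|%:E * QH_norm mu Q v p Omega
    (cutoff x t \* f)%R (grad (cutoff x t \* f)%R))%E).
    apply: lee_wpmul2r; last by rewrite lee_fin ler_norm.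
    by rewrite adde_ge0// poweR_ge0.
  by rewrite [leRHS]EFinM lee_wpmul2l.
rewrite EFinM; apply: (@le_trans _ _ (b4%:E * Lv_pow mu B v r (cutoff x t \* f)%R)%E).
  apply: le_trans (integral_innerZ_le _ b40 _); last first.
    by move=> y /BO Oy; rewrite lee_fin mulr_ge0 ?powR_ge0 ?v0.
  apply: le_integral_inner.
  - by move=> y [_ /UB].
  - by move=> y [/EOmega Oy _]; rewrite lee_fin mulr_ge0 ?powR_ge0 ?v0.
  - by move=> y /BO Oy; rewrite mule_ge0 ?lee_fin// mulr_ge0 ?powR_ge0 ?v0.
  move=> y [/EOmega Oy Uy]; rewrite -EFinM lee_fin mulrA ler_wpM2r ?v0//.
  have c0 : 0 < (t / 2) ^+ 2 by rewrite exprn_gt0// divr_gt0.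
  rewrite /b4 powRN mulrC ler_pdivlMr ?powR_gt0//.
  rewrite -powRM ?(ltW c0)//; apply: ge0_ler_powR; rewrite ?nnegrE;
    [exact: ltW|by apply: mulr_ge0 => //; exact: ltW|exact: normr_ge0|].
  rewrite /= normrM mulrC ler_wpM2r//.
  rewrite (ger0_norm (cutoff_ge0 _ _ _)); apply: cutoff_ge; exact: ltW.
by rewrite lee_wpmul2l// lee_fin.
Qed.

End global_sobolev.

(** * Vitali coverings with bounded overlap *)

Section covering.
Context {R : realType} {n : nat}.
Variables (Omega K : set 'rV[R]_n) (rho : 'rV[R]_n -> 'rV[R]_n -> R).
Hypothesis KOmega : K `<=` Omega.
Hypothesis cK : compact K.
Hypothesis hrho_open : balls_open Omega rho.
Hypothesis hrho : quasimetric Omega rho.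
Variable kappa : R.
Hypothesis kappa1 : 1 <= kappa.
Hypothesis hkappa : forall x y z, Omega x -> Omega y -> Omega z ->
      [/\ 0 <= rho x y, rho x y = 0 <-> x = y, rho x y = rho y x &
          rho x y <= kappa * (rho x z + rho z y)].
Local Notation B := (qball Omega rho).

Definition disjoint_balls (s : R) (l : seq 'rV[R]_n) :=
  uniq l /\ forall x y, x \in l -> y \in l -> B x s `&` B y s !=set0 -> x = y.

Lemma finite_ball_cover (s : R) : 0 < s -> exists l : seq 'rV[R]_n,
  (forall y, y \in l -> K y) /\
  (forall x, K x -> exists2 y, y \in l & B y s x).
Proof.
move=> s0; pose P (A : set 'rV[R]_n) := exists l : seq 'rV[R]_n,
  (forall y, y \in l -> K y) /\ (forall x, A x -> exists2 y, y \in l & B y s x).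
apply: (@compact_induction _ K P) => //.
- by exists [::]; split=> // x.
- move=> A A2 [l [lK lA]] [l2 [lK2 lA2]]; exists (l ++ l2); split=> [y|x].
    by rewrite mem_cat => /orP[/lK|/lK2].
  by case=> [/lA|/lA2] [y yl yx]; exists y => //; rewrite mem_cat yl ?orbT.
- by move=> A A2 AA2 [l [lK lA]]; exists l; split=> // x /AA2; exact: lA.
move=> x Kx; exists (B x s).
  apply: open_nbhs_nbhs; split; first exact: hrho_open (KOmega Kx) s0.
  exact: (qball_center hrho (KOmega Kx) s0).
exists [:: x]; split=> [y|z xz]; first by rewrite inE => /eqP ->.
by exists x => //; rewrite inE.
Qed.

(** The greedy choice: a ball is kept unless it meets one that was kept before. *)
Lemma disjoint_subfamily (s : R) (l : seq 'rV[R]_n) : exists l' : seq 'rV[R]_n,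
  [/\ disjoint_balls s l', {subset l' <= l} &
   forall x, x \in l -> x \in l' \/
     exists2 y, y \in l' & B x s `&` B y s !=set0].
Proof.
elim: l => [|x l [l' [[ul' dl'] sl' cl']]].
  by exists [::]; split=> //; split.
have [[y yl' xy]|nx] := pselect (exists2 y, y \in l' & B x s `&` B y s !=set0).
  exists l'; split=> [//|z /sl' zl|z]; first by rewrite inE zl orbT.
  by rewrite inE => /predU1P[->|/cl'//]; right; exists y.
have [xl'|xl'] := boolP (x \in l').
  exists l'; split=> [//|z /sl' zl|z]; first by rewrite inE zl orbT.
  by rewrite inE => /predU1P[->|/cl'//]; left.
exists (x :: l'); split=> [|z|z].
- split=> [/=|y z]; first by rewrite xl'.
  rewrite !inE => /predU1P[->|yl'] /predU1P[->|zl'] //.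
  + by move=> h; case: nx; exists z.
  + by rewrite setIC => h; case: nx; exists y.
  + exact: dl'.
- by rewrite !inE => /predU1P[->|/sl' ->]; rewrite ?eqxx ?orbT.
- rewrite !inE => /predU1P[->|/cl'[->|[y yl' zy]]]; rewrite ?eqxx ?orbT; [by left|by left|].
  by right; exists y => //; rewrite inE yl' orbT.
Qed.

(** If x lies in B(z, s) and this ball meets B(y, s) at w, two uses of the
    quasi-triangle inequality, from y to x through w and from w to x through z, give
    rho y x < kappa * (s + 2 * kappa * s) <= 3 * kappa^2 * s. *)
Lemma vitali_cover (s : R) : 0 < s -> exists l : seq 'rV[R]_n,
  [/\ disjoint_balls s l, forall y, y \in l -> K y &
   forall x, K x -> exists2 y, y \in l & B y (3 * kappa ^+ 2 * s) x].
Proof.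
move=> s0; have [l0 [l0K l0c]] := finite_ball_cover s0.
have [l [dl sl cl]] := disjoint_subfamily s l0.
exists l; split=> // [y /sl/l0K//|x Kx].
have [z zl0 [Ox zx]] := l0c x Kx.
have k1s : s <= kappa * s by rewrite ler_peMl// ltW.
have k2s : kappa * s <= kappa ^+ 2 * s.
  by rewrite expr2 -mulrA ler_peMl// (le_trans _ k1s)// ltW.
case: (cl z zl0) => [zl|[y yl [w [[Ow zw] [_ yw]]]]].
  exists z => //; split=> //; apply: (lt_le_trans zx).
  by rewrite -mulrA; lra.
have Oz : Omega z by apply: KOmega; exact: l0K.
have Oy : Omega y by apply: KOmega; apply: l0K; exact: sl.
exists y => //; split=> //.
have [_ _ _ h1] := hkappa Oy Ox Ow.
have [_ _ _ h2] := hkappa Ow Ox Oz.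
have [_ _ h3 _] := hkappa Ow Oz Oz.
have kp : 0 < kappa by exact: lt_le_trans kappa1.
apply: (le_lt_trans h1).
apply: (@lt_le_trans _ _ (kappa * (s + kappa * (s + s)))).
  rewrite ltr_pM2l// ltrD//; apply: (le_lt_trans h2).
  by rewrite ltr_pM2l// ltrD// h3.
have -> : kappa * (s + kappa * (s + s)) = kappa * s + 2 * (kappa ^+ 2 * s) by ring.
by rewrite -mulrA; lra.
Qed.

(** The centres of the balls B(y, r) that contain x lie in the ball of radius
    2 * kappa * r about any one of them, and the balls B(y, s) are disjoint, so
    the doubling condition bounds their number. It is applied at one of the
    centres, which belong to K, whereas x need not. *)
Lemma doubling_overlap (C : R -> R) (delta s r : R) (l : seq 'rV[R]_n) x :
  (forall t, 0 < t -> 0 < C t) ->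
  (forall s r x, 0 < s -> s <= r -> r < delta -> K x ->
     forall (m : nat) (y : 'I_m -> 'rV[R]_n), (forall i, B x r (y i)) ->
       trivIset [set: 'I_m] (fun i => B (y i) s) -> m%:R <= C (r / s)) ->
  0 < s -> s <= r -> 2 * kappa * r < delta ->
  disjoint_balls s l -> (forall y, y \in l -> K y) -> Omega x ->
  (count (fun y => `[< B y r x >]) l)%:R <= C (2 * kappa * r / s).
Proof.
move=> C0 HC s0 sr rd [ul dl] lK Ox.
have kp : 0 < kappa by exact: lt_le_trans kappa1.
have r0 : 0 < r by exact: lt_le_trans sr.
have k2r : s <= 2 * kappa * r.
  apply: (le_trans sr); apply: ler_peMl; first exact: ltW.
  by rewrite (le_trans kappa1)// ler_peMl ?(ltW kp)// ler1n.
rewrite -size_filter; set l1 := [seq _ <- l | _].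
have l1P y : y \in l1 -> y \in l /\ rho y x < r.
  by rewrite mem_filter => /andP[/asboolP[_ yx] yl].
have [l10|[y0 y0l1]] : l1 = [::] \/ exists y0, y0 \in l1.
  by case: (l1) => [|y0 l2]; [left|right; exists y0; rewrite inE eqxx].
  by rewrite l10 ltW//; apply: C0; rewrite divr_gt0// (lt_le_trans s0).
have [y0l y0x] := l1P _ y0l1.
have Oy0 : Omega y0 by exact/KOmega/lK.
apply: (HC s (2 * kappa * r) y0 s0 k2r rd (lK _ y0l) (size l1)
  (fun i => nth 0 l1 i)).
  move=> i; have [yl yx] := l1P _ (mem_nth 0 (ltn_ord i)).
  set y := nth _ _ _ in yl yx *.
  have Oy : Omega y by exact/KOmega/lK.
  split=> //; have [_ _ _ h] := hkappa Oy0 Oy Ox.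
  have [_ _ h2 _] := hkappa Ox Oy Oy.
  apply: (le_lt_trans h); have -> : 2 * kappa * r = kappa * (r + r) by ring.
  by rewrite ltr_pM2l// ltrD// h2.
move=> i j _ _ Bij.
have [il _] := l1P _ (mem_nth 0 (ltn_ord i)).
have [jl _] := l1P _ (mem_nth 0 (ltn_ord j)).
apply/val_inj/eqP; rewrite /= -(@nth_uniq _ 0 l1)//; last exact: seq.filter_uniq.
by apply/eqP; exact: dl.
Qed.

End covering.

(** * The Poincare estimate on E *)

Section poincare.
Context {R : realType} {n : nat} {M : set (set 'rV[R]_n)}.
Hypothesis hM_borel : open `<=` M.
Variable mu : {measure set (g_sigma_algebraType M) -> \bar R}.
Variables (Q : 'rV[R]_n -> 'M[R]_n) (v : 'rV[R]_n -> R) (p : R).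
Variables (Omega E : set 'rV[R]_n) (rho : 'rV[R]_n -> 'rV[R]_n -> R).
Hypothesis p1 : 1 <= p.
Hypothesis v0 : forall x, Omega x -> 0 <= v x.
Hypothesis mv : mu_measurable (M := M) Omega v.
Hypothesis oOmega : open Omega.
Hypothesis oE : open E.
Hypothesis hE_inside : compactly_inside E Omega.
Hypothesis hrho : quasimetric Omega rho.
Hypothesis hrho_open : balls_open Omega rho.
Hypothesis hrho_doubling : locally_geometrically_doubling Omega rho.
Hypothesis hpoincare : local_poincare mu Omega Q v p rho.
Variables (b V : R).
Hypothesis b0 : 0 <= b.
Hypothesis vV : (\int[mu]_(x in (E : set (g_sigma_algebraType M))) (v x)%:E <= V%:E)%E.

Let p0 : 0 < p. Proof. exact: lt_le_trans p1. Qed.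
Let EOmega : E `<=` Omega.
Proof. by case: hE_inside => _; apply: subset_trans; exact: subset_closure. Qed.
Let mOmega : measurable (Omega : set (g_sigma_algebraType M)).
Proof. exact: open_mu_measurable. Qed.
Let mE : measurable (E : set (g_sigma_algebraType M)).
Proof. exact: open_mu_measurable. Qed.
Let vE x : E x -> 0 <= v x. Proof. by move=> /EOmega; exact: v0. Qed.
Let mvS (A : set (g_sigma_algebraType M)) : A `<=` Omega -> measurable_fun A v.
Proof. by move=> AO; apply: measurable_funS mv. Qed.

Definition energy_le f := [/\ Lip0 E f, (Lv_pow mu E v p f <= b%:E)%E &
  (LQ_pow mu Q p E (grad f) <= b%:E)%E].

(** Since t <= 1 + t^p, the integral of |f| v over E is at most V + b. The point is
    that the bound is the same for all f of energy at most b. The inverse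
    takes the value 0 if v(B) is 0 or infinite, and the bound still holds. *)
Lemma average_le (B : set 'rV[R]_n) f :
  measurable (B : set (g_sigma_algebraType M)) -> B `<=` Omega -> energy_le f ->
  `|average mu v B f| <= (V + b) * `|(\int[mu]_(x in B) (v x))^-1|.
Proof.
move=> mB BO [fE fb _]; have cf := Lip0_continuous fE.
rewrite /average normrM ler_wpM2r ?normr_ge0//.
have mf A : measurable (A : set (g_sigma_algebraType M)) ->
  measurable_fun (A : set (g_sigma_algebraType M)) f.
  by move=> mA; exact: continuous_mu_measurable.
have mfv : measurable_fun (B : set (g_sigma_algebraType M))
    (fun x => (f x * v x)%:E).
  by apply/measurable_EFinP; apply: measurable_funM; [exact: mf|exact: mvS].
have H : (`|\int[mu]_(x in B) (f x * v x)%:E| <= (V + b)%:E)%E.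
  apply: (le_trans (le_abse_integral _ mB mfv)).
  apply: (@le_trans _ _ (Lv_pow mu Omega v 1 f)).
    apply: le_integral_inner => // x; rewrite ?abse_ge0//.
    - by move=> Ox; rewrite lee_fin mulr_ge0 ?powR_ge0 ?v0.
    - move=> /BO Ox; rewrite abse_EFin lee_fin powRr1// normrM.
      by rewrite (ger0_norm (v0 Ox)).
  rewrite (Lv_pow_Lip0 mu _ ltr01 fE)//.
  apply: (@le_trans _ _ (\int[mu]_(x in (E : set (g_sigma_algebraType M)))
     ((v x)%:E + (`|f x| `^ p * v x)%:E))%E).
    apply: ge0_le_integral => //.
    - by move=> x Ex; rewrite lee_fin mulr_ge0 ?powR_ge0 ?vE.
    - by apply: measurable_Lv_pow; [exact: mvS|exact: mf].
    - apply: emeasurable_funD; first by apply/measurable_EFinP; exact: mvS.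
      by apply: measurable_Lv_pow; [exact: mvS|exact: mf].
    move=> x Ex; rewrite -EFinD lee_fin -{2}[v x]mul1r -mulrDl ler_wpM2r ?vE//.
    rewrite powRr1//; have [f1|/ltW f1] := leP `|f x| 1.
      by rewrite (le_trans f1)// lerDl powR_ge0.
    apply: (@le_trans _ _ (`|f x| `^ p)); last by rewrite lerDr.
    by rewrite -[leLHS]powRr1// ler_powR.
  rewrite ge0_integralD//; last 3 first.
  - by apply/measurable_EFinP; exact: mvS.
  - by move=> x Ex; rewrite lee_fin mulr_ge0 ?powR_ge0 ?vE.
  - by apply: measurable_Lv_pow; [exact: mvS|exact: mf].
  by rewrite EFinD leeD.
have V0 : 0 <= V.
  rewrite -lee_fin (le_trans _ vV)//; apply: integral_ge0 => x Ex.
  by rewrite lee_fin vE.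
(* The real-valued integral is the finite part of X, which is finite by H. *)
move: H; rewrite /Rintegral; set X := (\int[mu]_(x in B) _)%E.
by case: X => [x| |] //=; rewrite ?lee_fin// normr0 addr_ge0.
Qed.

(** The p-th power of the local Poincare inequality. The energy of f is finite,
    so that the norms on the right may be treated as real numbers. *)
Lemma poincare_ball (eps : R) (B Bc : set 'rV[R]_n) f (c : R) : 0 < eps ->
  B `<=` Omega -> Bc `<=` Omega -> energy_le f ->
  (Lv_norm mu v p B (fun y => f y - c)%R <=
    eps%:E * QH_norm mu Q v p Bc f (grad f))%E ->
  (Lv_pow mu B v p (fun y => f y - c)%R <=
    ((2 * eps) `^ p)%:E * (Lv_pow mu Bc v p f + LQ_pow mu Q p Bc (grad f)))%E.
Proof.
move=> e0 BO BcO [fE fb gb] H.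
have X0 : (0 <= Lv_pow mu Bc v p f)%E by apply: Lv_pow_ge0 => x /BcO; exact: v0.
have Y0 := LQ_pow_ge0 mu Q p Bc (grad f).
have Xb : (Lv_pow mu Bc v p f <= b%:E)%E.
  apply: le_trans fb; rewrite -(Lv_pow_Lip0 mu v p0 fE EOmega).
  by apply: le_integral_inner => // x; [move=> /BcO|];
    move=> Ox; rewrite lee_fin mulr_ge0 ?powR_ge0 ?v0.
have Yb : (LQ_pow mu Q p Bc (grad f) <= b%:E)%E.
  apply: le_trans gb; rewrite -(LQ_pow_Lip0 mu Q p0 fE EOmega).
  by apply: le_integral_inner => // x _; rewrite lee_fin powR_ge0.
have Xfin : Lv_pow mu Bc v p f \is a fin_num.
  by rewrite ge0_fin_numE// (le_lt_trans Xb)// ltry.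
have Yfin : LQ_pow mu Q p Bc (grad f) \is a fin_num.
  by rewrite ge0_fin_numE// (le_lt_trans Yb)// ltry.
move: X0 Y0 H; set X := Lv_pow mu Bc v p f; set Y := LQ_pow mu Q p Bc _.
move=> X0 Y0 H.
have x0 : 0 <= fine X by exact: fine_ge0.
have y0 : 0 <= fine Y by exact: fine_ge0.
have s0 : 0 <= fine X `^ p^-1 + fine Y `^ p^-1 by rewrite addr_ge0 ?powR_ge0.
have nB : (Lv_norm mu v p B (fun y => f y - c)%R <=
    (eps * (fine X `^ p^-1 + fine Y `^ p^-1))%:E)%E.
  apply: (le_trans H); rewrite EFinM lee_wpmul2l ?lee_fin ?(ltW e0)//.
  by apply: (QH_norm_le p0 v0 BcO x0 y0); rewrite fineK.
have /poweR_inv_le h := nB.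
have {}h : (Lv_pow mu B v p (fun y => f y - c)%R <=
    ((eps * (fine X `^ p^-1 + fine Y `^ p^-1)) `^ p)%:E)%E.
  apply: h; [|exact: p0|by apply: mulr_ge0 s0; exact: ltW].
  by apply: integral_ge0 => x /BO Ox; rewrite lee_fin mulr_ge0 ?powR_ge0 ?v0.
apply: (le_trans h).
have -> : (((2 * eps) `^ p)%:E * (X + Y))%E =
    (eps `^ p * (2 `^ p * (fine X + fine Y)))%:E.
  by rewrite mulrA -powRM ?(ltW e0)// [eps * 2]mulrC EFinM EFinD !fineK.
rewrite lee_fin powRM ?(ltW e0)//.
rewrite ler_wpM2l ?powR_ge0//.
apply: (le_trans (powR_add_le (ltW p0) (powR_ge0 _ _) (powR_ge0 _ _))).
have invK t : 0 <= t -> (t `^ p^-1) `^ p = t.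
  by move=> t0; rewrite -powRrM mulVf ?powRr1 ?gt_eqF.
move: (fine X) (fine Y) x0 y0 => x y x0 y0.
by rewrite (invK _ x0) (invK _ y0) lexx.
Qed.

(** Summing [poincare_ball] over the family: as each point lies in at most N of
    the larger balls, the energies on the right add up to at most N times the
    energy of f. Superadditivity of the integral merges the two energy terms,
    and [integral_innerD_le] separates them again. *)
Lemma poincare_family (eps N : R) (l : seq 'rV[R]_n) (B Bc : 'rV[R]_n -> set 'rV[R]_n)
    f (c : 'rV[R]_n -> R) : 0 < eps ->
  (forall y, B y `<=` Omega) -> (forall y, Bc y `<=` Omega) -> energy_le f ->
  0 <= N ->
  (forall x, Omega x -> (count (fun y => `[< Bc y x >]) l)%:R <= N) ->
  (forall y, y \in l -> (Lv_norm mu v p (B y) (fun z => f z - c y)%R <=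
    eps%:E * QH_norm mu Q v p (Bc y) f (grad f))%E) ->
  (\sum_(y <- l) Lv_pow mu (B y) v p (fun z => f z - c y)%R <=
    ((2 * eps) `^ p * (N * (b + b)))%:E)%E.
Proof.
move=> e0 BO BcO fP N0 HN H; have [fE fb gb] := fP.
apply: (@le_trans _ _ (\sum_(y <- l) ((2 * eps) `^ p)%:E *
    (Lv_pow mu (Bc y) v p f + LQ_pow mu Q p (Bc y) (grad f)))%E).
  rewrite big_seq [leRHS]big_seq; apply: lee_sum => y yl.
  by apply: poincare_ball => //; exact: H.
rewrite -ge0_sume_distrr; last first.
  move=> y _; rewrite adde_ge0 ?LQ_pow_ge0//.
  by apply: Lv_pow_ge0 => x /BcO; exact: v0.
rewrite [leRHS]EFinM lee_wpmul2l ?lee_fin ?powR_ge0//.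
pose g x := enorm (mulmxv (sqrtmx (Q x)) (grad f x)) `^ p + `|f x| `^ p * v x.
have g1 x : 0 <= enorm (mulmxv (sqrtmx (Q x)) (grad f x)) `^ p by exact: powR_ge0.
have g2 x : Omega x -> 0 <= `|f x| `^ p * v x.
  by move=> Ox; rewrite mulr_ge0 ?powR_ge0 ?v0.
apply: (@le_trans _ _ (\sum_(y <- l)
    \int[mu]_(x in (Bc y : set (g_sigma_algebraType M))) (g x)%:E)%E).
  apply: lee_sum => y _; rewrite addeC /LQ_pow /Lv_pow.
  apply: (le_trans (integral_inner_superD _ _ _)) => //.
    by move=> x _; rewrite lee_fin.
  by move=> x /BcO Ox; rewrite lee_fin g2.
apply: (le_trans (sum_integral_overlap_le mu BcO _ N0 HN)).
  by move=> x Ox; rewrite addr_ge0 ?g2.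
rewrite EFinM lee_wpmul2l ?lee_fin//.
have mf : measurable_fun (Omega : set (g_sigma_algebraType M)) f.
  by apply: continuous_mu_measurable => //; exact: Lip0_continuous fE.
under eq_integral do rewrite EFinD.
apply: (le_trans (integral_innerD_le _ mOmega _ _ _)).
- by apply: measurable_Lv_pow mf => //; exact: mvS.
- by move=> x _; rewrite lee_fin.
- by move=> x Ox; rewrite lee_fin g2.
rewrite EFinD; apply: leeD.
  by have := gb; rewrite -(LQ_pow_Lip0 mu Q p0 fE EOmega).
by have := fb; rewrite -(Lv_pow_Lip0 mu v p0 fE EOmega).
Qed.

(** On each ball B of the family, f - g = (f - f_B) - (g - g_B) + (f_B - g_B).
    The first two terms are small by [poincare_family], and the
    third is what remains on the right. The order of the choices matters: the
    overlap bound N = C (2 kappa c0 L) depends only on kappa, c0 and the doubling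
    function, so that eps, and after it the radius, can be chosen in terms of N. *)
Lemma poincare_cover (eta : R) : 0 < eta ->
  exists (l : seq 'rV[R]_n) (r : R),
    [/\ 0 < r, forall y, y \in l -> Omega y &
      forall f g, energy_le f -> energy_le g ->
      (Lv_pow mu E v p (f \- g)%R <= (eta + 4 `^ p * V *
        \sum_(y <- l) `|average mu v (qball Omega rho y r) f
                        - average mu v (qball Omega rho y r) g| `^ p)%:E)%E].
Proof.
move=> eta0; have [cE EO] := hE_inside.
have [kappa [kappa1 hkappa]] := hrho.
have [c0 [c01 hP]] := hpoincare.
have [C [C0 /(_ _ cE EO)[delta delta0 HC]]] := hrho_doubling.
have kp : 0 < kappa by exact: lt_le_trans kappa1.
have cp : 0 < c0 by exact: lt_le_trans c01.
(* The balls B(y, s) are disjoint, the balls B(y, L s) cover, and the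
   Poincare inequality involves the balls B(y, c0 L s); their overlap is
   bounded by N, as D0 * s is the radius in [doubling_overlap]. *)
pose L := 3 * kappa ^+ 2; have L0 : 0 < L by rewrite mulr_gt0 ?exprn_gt0.
pose D0 := 2 * kappa * (c0 * L).
have D00 : 0 < D0 by rewrite !mulr_gt0.
pose N := C D0; have N0 : 0 < N by exact: C0.
pose K1 := eta / (4 `^ p * (4 * (N * b)) + 1).
have den0 : 0 < 4 `^ p * (4 * (N * b)) + 1.
  by rewrite ltr_wpDl// mulr_ge0 ?powR_ge0// mulr_ge0// mulr_ge0// ltW.
have K10 : 0 < K1 by rewrite divr_gt0.
(* This eps makes (2 eps)^p = K1, and K1 makes the sum of the two Poincare
   terms at most eta. *)
pose eps := K1 `^ p^-1 / 2.
have eps0 : 0 < eps by rewrite divr_gt0// powR_gt0.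
have epsK : (2 * eps) `^ p = K1.
  by rewrite mulrC divfK// -powRrM mulVf ?gt_eqF// powRr1// ltW.
have [delta1 delta10 Hd1] := hP _ cE EO eps eps0.
pose s := Num.min delta1 delta / 2 / D0.
have m0 : 0 < Num.min delta1 delta by rewrite lt_min delta10.
have s0 : 0 < s by rewrite !divr_gt0.
have D0s : D0 * s < Num.min delta1 delta.
  by rewrite /s mulrC divfK ?gt_eqF// ltr_pdivrMr// ltr_pMr// ltr1n.
have k2 : 1 <= 2 * kappa by rewrite (le_trans kappa1)// ler_peMl ?(ltW kp)// ler1n.
have LD : L <= D0.
  rewrite /D0 mulrA; apply: ler_peMl; first exact: ltW.
  by apply: (le_trans k2); apply: ler_peMr => //; exact: le_trans k2.
have L1 : 1 <= L.
  apply: (@le_trans _ _ (kappa ^+ 2)); first exact: exprn_ege1.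
  by apply: ler_peMl; [exact: exprn_ge0 (ltW kp)|rewrite ler1n].
pose r := L * s; have r0 : 0 < r by rewrite mulr_gt0.
have rd1 : r < delta1.
  apply: (@le_lt_trans _ _ (D0 * s)); first by rewrite ler_wpM2r// ltW.
  by apply: (lt_le_trans D0s); rewrite ge_min lexx.
have sr : s <= c0 * r.
  rewrite /r mulrA; apply: ler_peMl; first exact: ltW.
  by apply: (le_trans c01); apply: ler_peMr => //; exact: ltW.
have rd : 2 * kappa * (c0 * r) < delta.
  have -> : 2 * kappa * (c0 * r) = D0 * s by rewrite /D0 /r; ring.
  by apply: (lt_le_trans D0s); rewrite ge_min lexx orbT.
have [l [dl lK lc]] := vitali_cover EO cE hrho_open hrho kappa1 hkappa s0.
have HN x : Omega x ->
    (count (fun y => `[< qball Omega rho y (c0 * r) x >]) l)%:R <= N.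
  move=> Ox; have := doubling_overlap EO kappa1 hkappa C0 HC s0 sr rd dl lK Ox.
  congr (_ <= C _); rewrite /D0 /r; field; exact: lt0r_neq0.
have lO y : y \in l -> Omega y by move=> /lK /EO.
exists l, r; split=> // f g fP gP.
pose B y := qball Omega rho y r; pose a h y := average mu v (B y) h.
have BO y t : qball Omega rho y t `<=` Omega by move=> x [].
have fam h : energy_le h ->
    (\sum_(y <- l) Lv_pow mu (B y) v p (fun z => h z - a h y)%R <=
    (K1 * (N * (b + b)))%:E)%E.
  move=> hE; rewrite -epsK; apply: (@poincare_family eps N l B
    (fun y => qball Omega rho y (c0 * r)) h (a h) eps0) => //.
  - by move=> y; exact: BO.
  - exact: ltW.
  - move=> y yl; apply: Hd1 => //; first exact: lK.
    by case: hE => hE _ _; exact: Lip0_locally_lipschitz hE.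
have cf h : energy_le h -> continuous h.
  by case=> hE _ _; exact: Lip0_continuous hE.
have mB y : y \in l -> measurable (B y : set (g_sigma_algebraType M)).
  by move=> /lO Oy; apply: open_mu_measurable => //; exact: hrho_open.
have mc h (A : set (g_sigma_algebraType M)) : energy_le h -> measurable A ->
    measurable_fun A h.
  by move=> hE mA; apply: continuous_mu_measurable => //; exact: cf.
have mfg (A : set (g_sigma_algebraType M)) : measurable A ->
  measurable_fun A (f \- g) by move=> mA; apply: measurable_funB; exact: mc.
have V0 : 0 <= V.
  rewrite -lee_fin (le_trans _ vV)//; apply: integral_ge0 => x Ex.
  by rewrite lee_fin vE.
have piece y : y \in l ->
  (\int[mu]_(x in (E `&` B y : set (g_sigma_algebraType M)))
      (`|(f \- g) x| `^ p * v x)%:E <=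
    (4 `^ p)%:E * (Lv_pow mu (B y) v p (fun z => f z - a f y)%R
      + Lv_pow mu (B y) v p (fun z => g z - a g y)%R
      + (`|a f y - a g y| `^ p * V)%:E))%E.
  move=> yl; have mEB : measurable (E `&` B y : set (g_sigma_algebraType M)).
    exact: measurableI (mB y yl).
  have EBO : E `&` B y `<=` Omega by move=> x [/EOmega].
  have mvEB := mvS EBO.
  have vEB x : (E `&` B y) x -> 0 <= v x by move=> /EBO; exact: v0.
  have mcst h c : energy_le h ->
      measurable_fun (E `&` B y : set (g_sigma_algebraType M)) (fun z => h z - c).
    by move=> hE; apply: measurable_funB => //; exact: mc.
  apply: (le_trans (@Lv_powD3_le _ _ _ mu _ mEB _ mvEB vEB p
    (fun z => f z - a f y) (fun z => g z - a g y) (fun=> a f y - a g y) (f \- g)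
    (ltW p0) (mcst f _ fP) (mcst g _ gP) _ (mfg _ mEB) _)).
  - exact: measurable_cst.
  - move=> x _ /=.
    have -> : f x - g x = (f x - a f y) - (g x - a g y) + (a f y - a g y) by ring.
    apply: (le_trans (ler_normD _ _)); rewrite lerD2r.
    exact: ler_normB.
  rewrite lee_wpmul2l ?lee_fin ?powR_ge0//.
  have sub h : energy_le h ->
    (Lv_pow mu (E `&` B y) v p (fun z => h z - a h y)%R <=
     Lv_pow mu (B y) v p (fun z => h z - a h y)%R)%E.
    move=> hE; apply: le_integral_inner.
    - by move=> x [].
    - by move=> x /vEB vx; rewrite lee_fin mulr_ge0 ?powR_ge0.
    - by move=> x /BO Ox; rewrite lee_fin mulr_ge0 ?powR_ge0 ?v0.
    - by move=> x _.
  apply: leeD; first by apply: leeD; exact: sub.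
  apply: Lv_pow_cst_le => //.
  by apply: le_trans vV; apply: le_integral_inner.
have mh : measurable_fun (E : set (g_sigma_algebraType M))
    (fun x => (`|(f \- g) x| `^ p * v x)%:E).
  by apply: measurable_Lv_pow; [exact: mvS|exact: mfg].
have hh0 x : E x -> (0 <= (`|(f \- g) x| `^ p * v x)%:E)%E.
  by move=> Ex; rewrite lee_fin mulr_ge0 ?powR_ge0 ?vE.
have cov x : E x -> exists2 y, y \in l & B y x.
  by move=> Ex; apply: lc; exact: subset_closure.
apply: (le_trans (integral_cover_le mu mE mB mh hh0 cov)).
apply: (@le_trans _ _ (\sum_(y <- l) (4 `^ p)%:E *
   (Lv_pow mu (B y) v p (fun z => f z - a f y)%R
      + Lv_pow mu (B y) v p (fun z => g z - a g y)%R
      + (`|a f y - a g y| `^ p * V)%:E))%E).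
  by rewrite big_seq [leRHS]big_seq; apply: lee_sum => y; exact: piece.
have W0 h y : (0 <= Lv_pow mu (B y) v p (fun z => h z - a h y)%R)%E.
  by apply: Lv_pow_ge0 => x /BO; exact: v0.
rewrite -ge0_sume_distrr; last first.
  move=> y _; apply: adde_ge0; first by apply: adde_ge0; exact: W0.
  by rewrite lee_fin mulr_ge0 ?powR_ge0.
rewrite big_split big_split /= sumEFin -mulr_suml.
pose S : R := \sum_(y <- l) `|a f y - a g y| `^ p.
apply: (@le_trans _ _ ((4 `^ p)%:E *
    ((K1 * (N * (b + b)))%:E + (K1 * (N * (b + b)))%:E + (S * V)%:E))%E).
  rewrite lee_wpmul2l ?lee_fin ?powR_ge0//.
  by rewrite leeD2r// leeD ?fam.
rewrite -!EFinD -EFinM lee_fin -[X in _ <= _ + _ * X]/S.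
have -> : 4 `^ p * (K1 * (N * (b + b)) + K1 * (N * (b + b)) + S * V) =
  K1 * (4 `^ p * (4 * (N * b))) + 4 `^ p * V * S by ring.
rewrite lerD2r /K1 mulrAC ler_pdivrMr// ler_wpM2l ?(ltW eta0)//.
by rewrite lerDl.
Qed.

End poincare.

(** * The compact embedding *)

Section approximation.
Context {R : realType} {n : nat} {M : set (set 'rV[R]_n)}.
Variable mu : {measure set (g_sigma_algebraType M) -> \bar R}.
Variables (Q : 'rV[R]_n -> 'M[R]_n) (v : 'rV[R]_n -> R) (p : R).
Variables (Omega E : set 'rV[R]_n).
Hypothesis hM_borel : open `<=` M.
Hypothesis p0 : 0 < p.
Hypothesis v0 : forall x, Omega x -> 0 <= v x.
Hypothesis mv : mu_measurable (M := M) Omega v.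
Hypothesis oOmega : open Omega.
Hypothesis oE : open E.
Hypothesis EOmega : E `<=` Omega.
Hypothesis mQ : forall i j, mu_measurable (M := M) Omega (fun x => sqrtmx (Q x) i j).

Let mE : measurable (E : set (g_sigma_algebraType M)).
Proof. exact: open_mu_measurable. Qed.

Lemma measurable_LQ_integrand (k : 'rV[R]_n -> 'rV[R]_n) :
  (forall i, mu_measurable (M := M) E (fun x => k x 0 i)) ->
  measurable_fun (E : set (g_sigma_algebraType M))
    (fun x => (enorm (mulmxv (sqrtmx (Q x)) (k x)) `^ p)%:E).
Proof.
move=> mk; apply/measurable_EFinP.
apply: (measurableT_comp (measurable_powR p)).
under eq_fun do rewrite /enorm -powR12_sqrt ?sum_sqr_ge0//.
apply: (measurableT_comp (measurable_powR 2^-1)).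
apply: measurable_sum => i.
apply: (@measurableT_comp _ _ _ _ _ _ (fun y : R => y ^+ 2)).
  exact: measurable_funX.
under eq_fun do rewrite mxE.
apply: measurable_sum => j; apply: measurable_funM; first exact: mk.
under eq_fun do rewrite mxE.
apply: measurable_funS (mQ i j) => //; exact: open_mu_measurable.
Qed.

(** The triangle inequality for fields g of which nothing is known but their
    distance to the measurable field k; g will be a gradient. *)
Lemma LQ_pow_le_add (g k : 'rV[R]_n -> 'rV[R]_n) :
  (forall i, mu_measurable (M := M) E (fun x => k x 0 i)) ->
  (LQ_pow mu Q p E g <=
    (2 `^ p)%:E * (LQ_pow mu Q p E (g \- k)%R + LQ_pow mu Q p E k))%E.
Proof.
move=> mk; have F0 (h : 'rV[R]_n -> 'rV[R]_n) x :
    (0 <= (enorm (mulmxv (sqrtmx (Q x)) (h x)) `^ p)%:E)%E.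
  by rewrite lee_fin powR_ge0.
apply: (@le_trans _ _ (\int[mu]_(x in (E : set (g_sigma_algebraType M)))
   ((2 `^ p)%:E * ((enorm (mulmxv (sqrtmx (Q x)) ((g \- k) x)) `^ p)%:E
        + (enorm (mulmxv (sqrtmx (Q x)) (k x)) `^ p)%:E)))%E).
  apply: le_integral_inner => // x Ex.
    by rewrite mule_ge0 ?lee_fin ?powR_ge0// addr_ge0 ?powR_ge0.
  rewrite -EFinD -EFinM lee_fin.
  apply: le_trans (powR_add_le (ltW p0) (enorm_ge0 _) (enorm_ge0 _)).
  rewrite ge0_ler_powR ?nnegrE ?addr_ge0 ?enorm_ge0 ?(ltW p0)//.
  by rewrite -{1}[g x](subrK (k x)) mulmxvD enormD_le.
apply: (le_trans (integral_innerZ_le _ (powR_ge0 _ _) _)).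
  by move=> x _; rewrite -EFinD lee_fin addr_ge0 ?powR_ge0.
rewrite lee_wpmul2l ?lee_fin ?powR_ge0//.
by apply: integral_innerD_le => //; exact: measurable_LQ_integrand.
Qed.

(** The energy of the approximating function is bounded in terms of C alone,
    independently of e: this is what makes the estimates for Lip_0 functions
    uniform along a bounded sequence. *)
Lemma QH0_approximation u k (C e : R) : QH0 mu Q v p E u k ->
  (QH_norm mu Q v p E u k <= C%:E)%E -> 0 < e ->
  exists f, energy_le mu Q v p E (2 `^ p * (1 + C `^ p)) f /\
    (Lv_pow mu E v p (f \- u)%R <= e%:E)%E.
Proof.
move=> [[mu_ _] [mk _] [f [fE fcv]]] uC e0.
have vE x : E x -> 0 <= v x by move=> /EOmega; exact: v0.
have mvE : measurable_fun (E : set (g_sigma_algebraType M)) v.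
  by apply: measurable_funS mv => //; exact: open_mu_measurable.
pose c := Num.min 1 (e `^ p^-1).
have c0 : 0 < c by rewrite lt_min ltr01 powR_gt0.
have c1 : c `^ p <= 1.
  have -> : 1 = 1 `^ p :> R by rewrite powR1.
  rewrite ge0_ler_powR ?nnegrE ?(ltW p0) ?(ltW c0)//.
  by rewrite ge_min lexx.
have ce : c `^ p <= e.
  have -> : e = (e `^ p^-1) `^ p.
    by rewrite -powRrM mulVf ?gt_eqF// powRr1// ltW.
  rewrite ge0_ler_powR ?nnegrE ?powR_ge0 ?(ltW p0) ?(ltW c0)//.
  by rewrite ge_min lexx orbT.
have [j jc] : exists j, (QH_norm mu Q v p E (f j \- u)%R (grad (f j) \- k)%R <= c%:E)%E.
  have /fine_cvgP[ffin fc] := fcv.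
  have /cvgrPdist_le/(_ _ c0) fc' := fc.
  have [j [jf jc]] := @filter_ex _ _ _ _ (filterI ffin fc').
  exists j; move: jc; rewrite /= sub0r normrN => jc.
  by rewrite -(fineK jf) lee_fin (le_trans (ler_norm _)).
have [h1 h2] := QH_norm_ge p0 v0 EOmega jc.
have [h3 h4] := QH_norm_ge p0 v0 EOmega uC.
exists (f j); split; last by rewrite (le_trans h1)// lee_fin.
have mf : measurable_fun (E : set (g_sigma_algebraType M)) (f j).
  by apply: continuous_mu_measurable => //; exact: Lip0_continuous (fE j).
split; first exact: fE.
- apply: (le_trans (@Lv_powD_le _ _ _ mu _ mE v mvE vE p (f j \- u) u (f j)
    (ltW p0) _ mu_ mf _)).
  + exact: measurable_funB.
  + by move=> x _ /=; apply: (le_trans _ (ler_normD _ _)); rewrite subrK.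
  rewrite EFinM EFinD lee_wpmul2l ?lee_fin ?powR_ge0// leeD//.
  by rewrite (le_trans h1)// lee_fin.
- apply: (le_trans (LQ_pow_le_add _ mk)).
  rewrite EFinM EFinD lee_wpmul2l ?lee_fin ?powR_ge0// leeD//.
  by rewrite (le_trans h2)// lee_fin.
Qed.

End approximation.

Theorem corollary1p5 (R : realType) (n : nat) (p : R) (Omega : set 'rV[R]_n)
    (M : set (set 'rV[R]_n)) (mu : {measure set (g_sigma_algebraType M) -> \bar R})
    (Q : 'rV[R]_n -> 'M[R]_n) (v : 'rV[R]_n -> R) (c2 : R)
    (rho : 'rV[R]_n -> 'rV[R]_n -> R) (E : set 'rV[R]_n) (sigma : R)
    (hp : 1 < p)
    (hOmega_bounded : bounded_set Omega)
    (hOmega_open : open Omega)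
    (hOmega_connected : connected Omega)
    (hM : sigma_algebra setT M)
    (hM_borel : open `<=` M)
    (hmu_regular : regular_measure mu Omega)
    (hmu_ac : abs_continuous_lebesgue mu Omega)
    (hQ_measurable : forall i j, mu_measurable (M := M) Omega (fun x => Q x i j))
    (hQ_psd : forall x, Omega x -> psdmx (Q x))
    (hQ_Lp : sqrt_in_Lp mu Q p Omega)
    (hv : weight mu Omega v)
    (hc2 : 0 < c2)
    (hv0 : forall x, Omega x -> opnorm (Q x) `^ (p / 2) <= c2 * v x)
    (hrho : quasimetric Omega rho)
    (hrho_open : balls_open Omega rho)
    (hrho_inside : small_balls_inside Omega rho)
    (hrho_doubling : locally_geometrically_doubling Omega rho)
    (hE_open : open E)
    (hE_inside : compactly_inside E Omega)
    (hpoincare : local_poincare mu Omega Q v p rho)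
    (hsigma : 1 < sigma)
    (hsobolev : local_sobolev mu Omega Q v p sigma rho) :
  forall q : R, 1 <= q -> q < p * sigma ->
    (forall u k, QH0 mu Q v p E u k -> in_Lv mu v q E u) /\
    (forall (u : nat -> 'rV[R]_n -> R) (k : nat -> 'rV[R]_n -> 'rV[R]_n),
      (forall j, QH0 mu Q v p E (u j) (k j)) ->
      (exists C : R, forall j, (QH_norm mu Q v p E (u j) (k j) <= C%:E)%E) ->
      exists phi : nat -> nat, {homo phi : i j / (i < j)%N >-> (i < j)%N} /\
        exists w : 'rV[R]_n -> R, in_Lv mu v q E w /\
          Lv_norm mu v q E (u (phi j) \- w) @[j --> \oo] --> 0%E).
Proof.
move=> q q1 qr; set r := p * sigma.
have p0 : 0 < p by exact: lt_trans hp.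
have q0 : 0 < q by exact: lt_le_trans q1.
have s0 : 0 < sigma by exact: lt_trans hsigma.
have pr : p < r by rewrite /r -[ltLHS]mulr1 ltr_pM2l.
have r1 : 1 < r by exact: lt_trans pr.
have r0 : 0 < r by exact: lt_trans r1.
have [mv v0 v_int] := hv.
have [cE EO] := hE_inside.
have EOmega : E `<=` Omega by apply: subset_trans EO; exact: subset_closure.
have vE x : E x -> 0 <= v x by move=> /EOmega; exact: v0.
have mE : measurable (E : set (g_sigma_algebraType M)) by exact: open_mu_measurable.
have mvE : measurable_fun (E : set (g_sigma_algebraType M)) v.
  by apply: measurable_funS mv => //; exact: open_mu_measurable.
have mQ := hQ_Lp.1.
have [V vV] : exists V : R,
    (\int[mu]_(x in (E : set (g_sigma_algebraType M))) (v x)%:E <= V%:E)%E.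
  pose I := (\int[mu]_(x in (closure E : set (g_sigma_algebraType M))) (v x)%:E)%E.
  have I0 : (0 <= I)%E by apply: integral_ge0 => x /EO Ox; rewrite lee_fin v0.
  exists (fine I); rewrite fineK; last by rewrite ge0_fin_numE//; exact: v_int.
  apply: le_integral_inner => //; first exact: subset_closure.
  by move=> x /EO Ox; rewrite lee_fin v0.
have V0 : 0 <= V.
  rewrite -lee_fin (le_trans _ vV)//; apply: integral_ge0 => x Ex.
  by rewrite lee_fin vE.
(* L^r_v is contained in L^q_v, since v(E) is finite. *)
have inLq u (B : R) : measurable_fun (E : set (g_sigma_algebraType M)) u ->
    (Lv_pow mu E v r u <= B%:E)%E -> in_Lv mu v q E u.
  move=> mu_ uB; split; first exact: mu_.
  apply: poweR_lty.
  have [c c0 Hc] := @Lv_pow_interpolation _ _ _ mu _ mE v mvE vE r q r 1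
    r0 q0 qr ltr01.
  apply: (le_lt_trans (Hc u mu_)); rewrite mul1e.
  apply: (@le_lt_trans _ _ ((V + B + c * B)%:E)); last exact: ltry.
  rewrite !EFinD EFinM; apply: leeD; first exact: leeD.
  by rewrite lee_wpmul2l.
(* The Sobolev inequality on E extends from Lip_0(E) to QH_0. *)
have bound C : exists B : R, forall u k, QH0 mu Q v p E u k ->
    (QH_norm mu Q v p E u k <= C%:E)%E -> (Lv_pow mu E v r u <= B%:E)%E.
  pose b := 2 `^ p * (1 + C `^ p).
  have b0 : 0 <= b by rewrite mulr_ge0 ?addr_ge0 ?powR_ge0.
  have [B HB] := @global_sobolev R n M hM_borel mu Q v p c2 Omega E rho p0 v0 mv
    hc2 hv0 hOmega_open hE_open hE_inside hrho hrho_open sigma b s0 hsobolev b0.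
  exists (2 `^ r * B) => u k uk uC.
  have n0 (m : nat) : 0 < m.+1%:R^-1 :> R by rewrite invr_gt0.
  have /choice[f Hf] m := QH0_approximation hM_borel p0 v0 mv hOmega_open hE_open
    EOmega mQ uk uC (n0 m).
  have [[mu_ _] _ _] := uk.
  apply: (@Lv_pow_limit_le _ _ _ mu _ mE v mvE vE p r f u B p0 (ltW pr)) => //.
    move=> j; have [[fE _ _] _] := Hf j.
    by apply: continuous_mu_measurable => //; exact: Lip0_continuous fE.
  move=> e e0; exists (Num.truncn e^-1).
  have [[fE fb gb] fu] := Hf (Num.truncn e^-1); split; last exact: HB.
  apply: (le_trans fu); rewrite lee_fin invf_ple ?posrE//.
  exact/ltW/truncnS_gt.
split=> [u k uk|u k uk [C uC]].
  have [[mu_ uLv] [_ kLQ] _] := uk.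
  have [B HB] := bound (fine (QH_norm mu Q v p E u k)).
  apply: (inLq u B); first exact: mu_.
  apply: (HB u k uk); rewrite fineK// ge0_fin_numE.
    by rewrite lte_add_pinfty.
  by rewrite adde_ge0// poweR_ge0.
have [B HB] := bound C.
have n0 (m : nat) : 0 < m.+1%:R^-1 :> R by rewrite invr_gt0.
have /choice[f Hf] j := QH0_approximation hM_borel p0 v0 mv hOmega_open hE_open
  EOmega mQ (uk j) (uC j) (n0 j).
pose b := 2 `^ p * (1 + C `^ p).
have b0 : 0 <= b by rewrite mulr_ge0 ?addr_ge0 ?powR_ge0.
have fP j : energy_le mu Q v p E b (f j) by have [] := Hf j.
have mf j : measurable_fun (E : set (g_sigma_algebraType M)) (f j).
  have [fE _ _] := fP j.
  by apply: continuous_mu_measurable => //; exact: Lip0_continuous fE.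
have mu_ j : measurable_fun (E : set (g_sigma_algebraType M)) (u j).
  by have [[]] := uk j.
have [|phi [phi_incr phiC]] := @totally_bounded_cauchy_subsequence R
    (fun j l => Lv_pow mu E v p (f j \- f l)%R) p p0.
  move=> e e0.
  have [l [s [s_gt0 lO Hl]]] := poincare_cover hM_borel (ltW hp) v0 mv hOmega_open
    hE_open hE_inside hrho hrho_open hrho_doubling hpoincare b0 vV e0.
  (* A centre outside Omega does not occur in l, but the sequence a y has to be
     bounded for every y, and balls are known to be open only for centres in
     Omega. *)
  pose a y j := if `[< Omega y >] then average mu v (qball Omega rho y s) (f j)
                else 0.
  exists _, l, a, (4 `^ p * V); split; first by rewrite mulr_ge0 ?powR_ge0.
    move=> y; rewrite /a; case: asboolP => Oy.
      exists ((V + b) * `|(\int[mu]_(x in qball Omega rho y s) (v x))^-1|) => j.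
      apply: (average_le hM_borel (ltW hp) v0 mv hOmega_open hE_open hE_inside vV
        _ _ (fP j)) => [|x []//].
      by apply: open_mu_measurable => //; exact: hrho_open.
    by exists 0 => j; rewrite normr0.
  move=> j m; apply: (le_trans (Hl _ _ (fP j) (fP m))).
  rewrite lee_fin lerD2l ler_wpM2l ?mulr_ge0 ?powR_ge0//.
  rewrite big_seq [leRHS]big_seq; apply: ler_sum => y yl.
  by rewrite /a asboolT//; exact: lO.
have phi_ge j : (j <= phi j)%N.
  by elim: j => // j IH; apply: (leq_ltn_trans IH); exact: phi_incr.
exists phi; split=> //.
(* u (phi j) - u (phi l) differs from f (phi j) - f (phi l) by two terms of
   size 1 / (phi j + 1) and 1 / (phi l + 1). *)
have uC' e : 0 < e -> exists N, forall j l, (N <= j)%N -> (N <= l)%N ->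
    (Lv_pow mu E v p (u (phi j) \- u (phi l))%R <= e%:E)%E.
  move=> e0; pose e' := e / (4 `^ p * 3).
  have p4 : 0 < 4 `^ p :> R by rewrite powR_gt0.
  have e'0 : 0 < e' by rewrite divr_gt0// mulr_gt0.
  have [N1 HN1] := phiC e' e'0; pose N2 := Num.truncn e'^-1.
  exists (maxn N1 N2) => j l; rewrite !geq_max => /andP[j1 j2] /andP[l1 l2].
  have small m : (N2 <= m)%N ->
      (Lv_pow mu E v p (f (phi m) \- u (phi m))%R <= e'%:E)%E.
    move=> Nm; have [_ h] := Hf (phi m); apply: (le_trans h).
    rewrite lee_fin invf_ple ?posrE//; apply: (le_trans (ltW (truncnS_gt _))).
    by rewrite ler_nat ltnS (leq_trans Nm).
  apply: (le_trans (@Lv_powD3_le _ _ _ mu _ mE v mvE vE p (f (phi j) \- u (phi j))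
    (f (phi j) \- f (phi l)) (f (phi l) \- u (phi l)) (u (phi j) \- u (phi l))
    (ltW p0) _ _ _ _ _)).
  - exact: measurable_funB.
  - exact: measurable_funB.
  - exact: measurable_funB.
  - exact: measurable_funB.
  - move=> x _ /=.
    have -> : u (phi j) x - u (phi l) x = - (f (phi j) x - u (phi j) x)
      + (f (phi j) x - f (phi l) x) + (f (phi l) x - u (phi l) x) by ring.
    apply: (le_trans (ler_normD _ _)); rewrite lerD2r.
    by apply: (le_trans (ler_normD _ _)); rewrite normrN.
  apply: (@le_trans _ _ ((4 `^ p)%:E * (e'%:E + e'%:E + e'%:E))%E).
    rewrite lee_wpmul2l ?lee_fin ?(ltW p4)//.
    by apply: leeD; [apply: leeD|]; [exact: small|exact: HN1|exact: small].
  rewrite -!EFinD -EFinM lee_fin.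
  have -> : 4 `^ p * (e' + e' + e') = e' * (4 `^ p * 3) by ring.
  by rewrite divfK// gt_eqF// mulr_gt0.
have [w [mw wB Hw]] := Lv_cauchy_limit mE mvE vE p0 q0 qr r1 vV
  (fun j => mu_ (phi j)) (fun j => HB _ _ (uk (phi j)) (uC (phi j))) uC'.
exists w; split; first exact: inLq mw wB.
apply: cvge0_le => [j|e e0]; first exact: poweR_ge0.
have [N HN] := Hw _ (powR_gt0 q e0).
exists N => j Nj; apply/poweR_inv_le => //; [|exact: ltW|exact: HN].
by apply: Lv_pow_ge0.
Qed.
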